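(* Let $n\ge 1$. The space $\mathcal{D}_n$ of $n$-marked Dyer systems is a closed subset of the space $\mathcal{G}_n$ of $n$-marked groups.
   Context: **Marked groups.** An $n$-marked group is a pair $(G,S)$ where $G$ is a group and $S=(s_1,\dots,s_n)$ is an ordered generating set of $G$. Two $n$-marked groups $(G,S)$, $(H,T)$ are isomorphic if $s_i\mapsto t_i$ extends to a group isomorphism $G\to H$. $\mathcal{G}_n$ is the set of isomorphism classes of $n$-marked groups. Fix the free group $\mathbb{F}_n$ with an ordered free basis $X=(x_1,\dots,x_n)$; let $\pi_{(G,S)}:\mathbb{F}_n\to G$ be the epimorphism $x_i\mapsto s_i$, and let $B(R)$ be the ball of radius $R$ about $1$ in $\mathbb{F}_n$ for the word length with respect to $X$. The metric on $\mathcal{G}_n$ is $d((G,S),(H,T))=e^{-v}$, where $v=\max\{R\ge 0: B(R)\cap\ker\pi_{(G,S)}=B(R)\cap\ker\pi_{(H,T)}\}$ ($v=\infty$ and $d=0$ if the kernels coincide). **Dyer systems.** Let $\widehat{\mathbb{N}}=\mathbb{N}\cup\{\infty\}$ and $[a,b]_k=aba\cdots$ ($k$ alternating factors). A pair $(D,S)$ with $D$ a group generated by $S=\{s_1,\dots,s_n\}$ is a Dyer system if $D$ admits a presentation $$D=\langle s_1,\dots,s_n\mid s_i^{f_i}=1,\ [s_i,s_j]_{m_{ij}}=[s_j,s_i]_{m_{ij}}\ (i\neq j)\rangle,$$ where $f_i\in\widehat{\mathbb{N}}_{\ge 2}$, $m_{ij}=m_{ji}\in\widehat{\mathbb{N}}_{\ge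 2}$, and $m_{ij}\in\{2,\infty\}$ whenever $f_i\ge 3$ or $f_j\ge 3$; relations with $f_i=\infty$ or $m_{ij}=\infty$ are omitted. If $S$ is totally ordered, $S=(s_1,\dots,s_n)$, then $(D,S)$ is an $n$-marked Dyer system. $\mathcal{D}_n\subset\mathcal{G}_n$ is the subspace of (isomorphism classes of) $n$-marked Dyer systems. *)

(* Defs.v *)
From HB Require Import structures.
From mathcomp Require Import all_boot all_order all_algebra.
From mathcomp Require Import all_classical all_reals all_analysis.

Set Implicit Arguments.
Unset Strict Implicit.
Unset Printing Implicit Defensive.

Import Order.TTheory GRing.Theory Num.Theory.

Local Open Scope classical_set_scope.
Local Open Scope group_scope.

(* Letters are signed indices: (i, false) stands for x_i, (i, true) for its
   inverse. *)
Notation letter n := ('I_n * bool)%type.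

Definition linv n (a : letter n) : letter n := (a.1, ~~ a.2).

Definition reduced n (w : seq (letter n)) : bool :=
  sorted (fun a b => b != linv a) w.

Definition lpush n (a : letter n) (w : seq (letter n)) : seq (letter n) :=
  if w is b :: w' then if b == linv a then w' else a :: w else [:: a].

Definition winv n (w : seq (letter n)) : seq (letter n) :=
  rev (map (@linv n) w).

Section ReducedWords.
Variable n : nat.
Implicit Types (a b : letter n) (u v w : seq (letter n)).

Lemma linvK : involutive (@linv n).
Proof. by case=> i b; rewrite /linv /= negbK. Qed.

Lemma linv_neq a : linv a != a.
Proof. by case: a => i []; rewrite /linv xpair_eqE /= andbF. Qed.

Lemma reduced_tail a w : reduced (a :: w) -> reduced w.
Proof. exact: path_sorted. Qed.

Lemma lpush_reduced a w : reduced w -> reduced (lpush a w).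
Proof.
case: w => [|b w] //= red; case: ifPn => [_|ne]; first exact: path_sorted red.
by rewrite /reduced /= ne.
Qed.

Lemma lpush_id a w : reduced (a :: w) -> lpush a w = a :: w.
Proof. by case: w => [|b w] //= /andP[/negbTE-> _]. Qed.

Lemma lpushK a w : reduced w -> lpush a (lpush (linv a) w) = w.
Proof.
case: w => [|b w] /=; first by rewrite eqxx.
rewrite linvK; case: eqP => [->|_] red /=; last by rewrite eqxx.
exact: lpush_id.
Qed.

Lemma foldr_lpush_reduced u v : reduced v -> reduced (foldr (@lpush n) v u).
Proof. by move=> rv; elim: u => //= a u IH; exact: lpush_reduced. Qed.

Lemma foldr_lpush_lpush a u v : reduced v ->
  foldr (@lpush n) v (lpush a u) = lpush a (foldr (@lpush n) v u).
Proof.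
move=> rv; case: u => [|b u] //=; case: eqP => [->|_] //=.
by rewrite lpushK //; exact: foldr_lpush_reduced.
Qed.

Lemma foldr_lpushA u v w : reduced w ->
  foldr (@lpush n) w (foldr (@lpush n) v u) =
  foldr (@lpush n) (foldr (@lpush n) w v) u.
Proof. by move=> rw; elim: u => //= a u <-; exact: foldr_lpush_lpush. Qed.

Lemma foldr_lpush_nil u : reduced u -> foldr (@lpush n) [::] u = u.
Proof.
elim: u => //= a u IH red; rewrite IH ?lpush_id //; exact: reduced_tail red.
Qed.

Lemma winv_reduced u : reduced u -> reduced (winv u).
Proof.
rewrite /reduced /winv rev_sorted sorted_map; apply: sub_sorted => a b /=.
by apply: contraNneq => ->; rewrite !linvK.
Qed.

Lemma winvK : involutive (@winv n).
Proof. by move=> u; rewrite /winv map_rev revK mapK //; exact: linvK. Qed.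

Lemma foldr_lpush_winv u w : reduced w ->
  foldr (@lpush n) (foldr (@lpush n) w u) (winv u) = w.
Proof.
elim: u w => //= a u IH w rw; rewrite /winv /= rev_cons -cats1 foldr_cat /=.
rewrite -{2}[a]linvK lpushK ?foldr_lpush_reduced //; exact: IH.
Qed.

End ReducedWords.

(* The free group of rank n, realised on reduced words. *)
Record free_group (n : nat) :=
  FreeGroup { fword : seq (letter n); _ : reduced fword }.

HB.instance Definition _ n := [isSub for @fword n].
HB.instance Definition _ n := [Countable of free_group n by <:].

Section FreeGroup.
Variable n : nat.
Implicit Types u v : free_group n.

Lemma fwordP u : reduced (fword u). Proof. by case: u. Qed.

Definition fone : free_group n := @FreeGroup n [::] isT.

Definition fmul u v : free_group n :=
  FreeGroup (foldr_lpush_reduced (fword u) (fwordP v)).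

Definition finv u : free_group n := FreeGroup (winv_reduced (fwordP u)).

Lemma fmulA : associative fmul.
Proof. by move=> u v w; apply: val_inj; rewrite /= foldr_lpushA ?fwordP. Qed.

Lemma fmul1g : left_id fone fmul.
Proof. by move=> u; exact: val_inj. Qed.

Lemma fmulg1 : right_id fone fmul.
Proof. by move=> u; apply: val_inj; exact: foldr_lpush_nil (fwordP u). Qed.

Lemma fmulVg : left_inverse fone finv fmul.
Proof.
move=> u; apply: val_inj => /=.
by rewrite -[X in foldr _ X _](foldr_lpush_nil (fwordP u)) foldr_lpush_winv.
Qed.

Lemma fmulgV : right_inverse fone finv fmul.
Proof.
move=> u; rewrite -[X in fmul X _](_ : finv (finv u) = u) ?fmulVg //.
by apply: val_inj; exact: winvK.
Qed.

HB.instance Definition _ :=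
  isGroup.Build (free_group n) fmulA fmul1g fmulg1 fmulVg fmulgV.

Definition fgen (i : 'I_n) : free_group n := @FreeGroup n [:: (i, false)] isT.

End FreeGroup.

Definition letter_val n (G : groupType) (s : 'I_n -> G) (a : letter n) : G :=
  if a.2 then (s a.1)^-1 else s a.1.

Definition word_val n (G : groupType) (s : 'I_n -> G) (w : seq (letter n)) : G :=
  \prod_(a <- w) letter_val s a.

(* The homomorphism from the free group to G sending x_i to s_i. *)
Definition free_lift n (G : groupType) (s : 'I_n -> G) (u : free_group n) : G :=
  word_val s (fword u).

Section FreeLift.
Variables (n : nat) (G : groupType) (s : 'I_n -> G).

Lemma letter_valV a : letter_val s (linv a) = (letter_val s a)^-1.
Proof. by case: a => i []; rewrite /letter_val /= ?invgK. Qed.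

Lemma word_val_lpush a w :
  word_val s (lpush a w) = letter_val s a * word_val s w.
Proof.
rewrite /word_val; case: w => [|b w] /=; first by rewrite !big_cons.
case: eqP => [->|_]; rewrite !big_cons //.
by rewrite letter_valV mulVKg.
Qed.

Lemma free_liftM : {morph free_lift s : u v / u * v}.
Proof.
move=> u v; rewrite /free_lift /=; elim: (fword u) => /= [|a w IH].
  by rewrite /word_val big_nil mul1g.
by rewrite word_val_lpush IH mulgA /word_val big_cons.
Qed.

Lemma free_lift1 : free_lift s 1 = 1.
Proof. by rewrite /free_lift /word_val big_nil. Qed.

HB.instance Definition _ := isUMagmaMorphism.Build _ _ (free_lift s)
  (free_lift1, free_liftM).

Lemma free_liftV u : free_lift s u^-1 = (free_lift s u)^-1.
Proof.
by apply: (mulIg (free_lift s u)); rewrite -free_liftM !mulVg free_lift1.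
Qed.

Lemma free_lift_gen i : free_lift s (fgen i) = s i.
Proof. by rewrite /free_lift /word_val big_seq1. Qed.

End FreeLift.

Definition is_subgroup (G : groupType) (H : set G) : Prop :=
  [/\ H 1, (forall x y, H x -> H y -> H (x * y)) & (forall x, H x -> H x^-1)].

Definition is_normal_subgroup (G : groupType) (H : set G) : Prop :=
  is_subgroup H /\ forall x g, H x -> H (x ^ g).

Definition subgroup_generated (G : groupType) (A : set G) : set G :=
  smallest (@is_subgroup G) A.

Definition normal_closure (G : groupType) (A : set G) : set G :=
  smallest (@is_normal_subgroup G) A.

Lemma free_lift_surj n (G : groupType) (s : 'I_n -> G) :
  subgroup_generated (range s) = setT -> forall g, exists u, free_lift s u = g.
Proof.
move=> gs g; have : subgroup_generated (range s) g by rewrite gs.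
move=> /(_ [set h | exists u, free_lift s u = h]); apply.
split; last by move=> _ [i _ <-]; exists (fgen i); exact: free_lift_gen.
split=> [|_ _ [u <-] [v <-]|_ [u <-]].
- by exists 1; exact: free_lift1.
- by exists (u * v); exact: free_liftM.
- by exists u^-1; exact: free_liftV.
Qed.

(* The underlying group is stored as a carrier and a class, rather than as a
   groupType, so that the carrier may live in a universe below that of
   choiceType; otherwise the type of marked groups could not itself be a
   choiceType. No isomorphism class is lost: see marked_group_exists. *)
Record marked_group (n : nat) := MarkedGroup {
  mg_carrier : Type;
  mg_class : Group.axioms_ mg_carrier;
  mg_gen : 'I_n -> Group.Pack mg_class;
  mg_genP : subgroup_generated (range mg_gen) = setT }.

Coercion mg_group n (M : marked_group n) : groupType := Group.Pack (mg_class M).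

Lemma marked_group_exists n (G : groupType) (s : 'I_n -> G) :
  subgroup_generated (range s) = setT ->
  exists (M : marked_group n) (f : M -> G),
    [/\ {morph f : x y / x * y}, bijective f & forall i, f (mg_gen M i) = s i].
Proof.
move=> gs; have [h hP] := choice (free_lift_surj gs).
pose P k := `[< exists g, pickle (h g) = k >].
pose T := {k : nat | P k}.
have encP g : P (pickle (h g)) by apply/asboolP; exists g.
pose enc g : T := exist (fun k => P k) _ (encP g).
have preim (t : T) : exists g, pickle (h g) = val t.
  by case: t => k Pk; exact: (asboolP _ Pk).
have [dec decE] := choice preim.
have decK : cancel dec enc by move=> t; apply: val_inj; exact: decE.
have encK : cancel enc dec.
  by move=> g; rewrite -[LHS]hP -[RHS]hP (pcan_inj pickleK (decE (enc g))).
pose mulT x y := enc (dec x * dec y); pose invT x := enc (dec x)^-1.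
have mulA : associative mulT by move=> x y z; rewrite /mulT !encK mulgA.
have mul1 : left_id (enc 1) mulT by move=> x; rewrite /mulT encK mul1g decK.
have mulr1 : right_id (enc 1) mulT by move=> x; rewrite /mulT encK mulg1 decK.
have mulV : left_inverse (enc 1) invT mulT.
  by move=> x; rewrite /mulT encK mulVg.
have mulrV : right_inverse (enc 1) invT mulT.
  by move=> x; rewrite /mulT encK mulgV.
pose Tg : groupType := HB.pack T (isGroup.Build T mulA mul1 mulr1 mulV mulrV).
have decM : {morph (dec : Tg -> G) : x y / x * y} by move=> x y; exact: encK.
have dec1 : dec (1 : Tg) = 1 by exact: encK.
have decV x : dec ((x : Tg)^-1) = (dec x)^-1 by exact: encK.
pose sT i : Tg := enc (s i).
have gsT : subgroup_generated (range sT) = setT.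
  apply/seteqP; split=> // x _ H [[H1 HM HV] Hs].
  have [u ux] := free_lift_surj gs (dec x).
  suff -> : x = free_lift sT u :> Tg.
    rewrite /free_lift /word_val; elim/big_ind: _ => // -[i []] _.
      by apply: HV; apply: Hs; exists i.
    by apply: Hs; exists i.
  apply: (can_inj decK); rewrite -ux /free_lift /word_val (big_morph _ decM dec1).
  by apply: eq_bigr => -[i []] _; rewrite /letter_val /= ?decV /sT encK.
exists (@MarkedGroup n T (Group.class Tg) sT gsT), dec; split=> //.
- by exists enc.
- by move=> i; exact: encK.
Qed.

HB.instance Definition _ n := gen_eqMixin (marked_group n).
HB.instance Definition _ n := gen_choiceMixin (marked_group n).

Definition marked_iso n (M N : marked_group n) : Prop :=
  exists f : M -> N,
    [/\ {morph f : x y / x * y}, bijective f &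
        forall i, f (mg_gen M i) = mg_gen N i].

Definition marked_proj n (M : marked_group n) : free_group n -> M :=
  free_lift (mg_gen M).

Definition marked_ker n (M : marked_group n) : set (free_group n) :=
  [set u | marked_proj M u = 1].

(* Ball of radius k about 1 for the word length with respect to the basis. *)
Definition word_ball n (k : nat) : set (free_group n) :=
  [set u | exists2 w : seq (letter n), (size w <= k)%N & word_val (@fgen n) w = u].

Definition agree_upto n (M N : marked_group n) : set nat :=
  [set k | @word_ball n k `&` marked_ker M = @word_ball n k `&` marked_ker N].

(* The largest element of the set above; it exists exactly when the kernels
   differ (see agree_maxP), and is only used in that case. *)
Definition agree_max n (M N : marked_group n) : nat :=
  xget 0%N [set v | agree_upto M N v /\
    forall k, agree_upto M N k -> (k <= v)%N].

Definition marked_dist (R : realType) n (M N : marked_group n) : R :=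
  if `[< marked_ker M = marked_ker N >] then 0%R
  else expR (- (agree_max M N)%:R)%R.

Section MarkedGroups.
Variable n : nat.
Implicit Types M N P : marked_group n.

Lemma marked_proj_surj M (g : M) : exists u, marked_proj M u = g.
Proof. exact: free_lift_surj (@mg_genP n M) g. Qed.

Lemma marked_iso_refl M : marked_iso M M.
Proof. by exists idfun; split=> //; exists idfun. Qed.

Lemma marked_iso_sym M N : marked_iso M N -> marked_iso N M.
Proof.
case=> f [fM [g fK gK] fs]; exists g; split; last 2 first.
- by exists f.
- by move=> i; rewrite -fs fK.
by move=> x y; apply: (can_inj fK); rewrite fM !gK.
Qed.

Lemma marked_iso_trans M N P :
  marked_iso M N -> marked_iso N P -> marked_iso M P.
Proof.
case=> f [fM fb fs] [g [gM gb gs]]; exists (g \o f); split.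
- by move=> x y; rewrite /= fM gM.
- exact: bij_comp.
- by move=> i; rewrite /= fs gs.
Qed.

Lemma marked_proj_morph M N (f : M -> N) :
  {morph f : x y / x * y} -> (forall i, f (mg_gen M i) = mg_gen N i) ->
  forall u, f (marked_proj M u) = marked_proj N u.
Proof.
move=> fM fs u.
have f1 : f 1 = 1 by apply: (mulgI (f 1)); rewrite -fM !mulg1.
have fV x : f x^-1 = (f x)^-1 by apply: (mulIg (f x)); rewrite -fM !mulVg.
rewrite /marked_proj /free_lift /word_val (big_morph f fM f1).
apply: eq_bigr => -[i []] _; rewrite /letter_val /= ?fV fs //.
Qed.

Lemma marked_isoP M N : marked_iso M N <-> marked_ker M = marked_ker N.
Proof.
split=> [[f [fM /bij_inj fI fs]]|kerE].
  have f1 : f 1 = 1 by apply: (mulgI (f 1)); rewrite -fM !mulg1.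
  apply/seteqP; split=> u; rewrite /marked_ker /= -(marked_proj_morph fM fs).
    by move=> ->.
  by rewrite -f1 => /fI.
have proj_eq (A B : marked_group n) : marked_ker A = marked_ker B ->
    forall u v, marked_proj A u = marked_proj A v ->
    marked_proj B u = marked_proj B v.
  move=> E u v Euv.
  have : marked_ker A (u * v^-1).
    by rewrite /marked_ker /marked_proj /= free_liftM free_liftV -/(marked_proj A v)
         -/(marked_proj A u) Euv mulgV.
  rewrite E /marked_ker /marked_proj /= free_liftM free_liftV => Ev.
  by apply: (mulIg (marked_proj B v)^-1); rewrite mulgV.
have [h hP] := choice (@marked_proj_surj M).
have [k kP] := choice (@marked_proj_surj N).
have fE u : marked_proj N (h (marked_proj M u)) = marked_proj N u.
  by apply: proj_eq kerE _ _ _.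
have gE u : marked_proj M (k (marked_proj N u)) = marked_proj M u.
  by apply: proj_eq (esym kerE) _ _ _.
exists (fun x => marked_proj N (h x)); split.
- move=> x y; rewrite -{1}[x]hP -{1}[y]hP -free_liftM fE.
  exact: free_liftM.
- exists (fun y => marked_proj M (k y)) => x.
    by rewrite gE hP.
  by rewrite fE kP.
- by move=> i; rewrite -{1}(free_lift_gen (mg_gen M) i) fE /marked_proj free_lift_gen.
Qed.

Lemma word_val_fgen (u : free_group n) : word_val (@fgen n) (fword u) = u.
Proof.
case: u => w rw; apply: val_inj => /=.
elim: w rw => [_|a w IH rw]; first by rewrite /word_val big_nil.
rewrite /word_val big_cons -/(word_val _ _).
have {}IH := IH (reduced_tail rw).
have -> : letter_val (@fgen n) a = @FreeGroup n [:: a] isT.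
  by case: a {rw} => i []; rewrite /letter_val //=; apply: val_inj.
by rewrite /= IH lpush_id.
Qed.

Lemma word_ball0 : @word_ball n 0 = [set 1].
Proof.
apply/seteqP; split=> u /=; last by move=> ->; exists [::]; rewrite // /word_val big_nil.
by case=> -[|//] _ <-; rewrite /word_val big_nil.
Qed.

Lemma word_ball_le k l : (k <= l)%N -> @word_ball n k `<=` @word_ball n l.
Proof. by move=> kl u [w sw <-]; exists w => //; exact: leq_trans kl. Qed.

Lemma marked_ker1 M : marked_ker M 1. Proof. exact: free_lift1. Qed.

Lemma agree_upto0 M N : agree_upto M N 0%N.
Proof.
by rewrite /agree_upto /= word_ball0; apply/seteqP; split=> u /= [-> _];
  split=> //; exact: marked_ker1.
Qed.

Lemma agree_upto_le M N k l :
  (k <= l)%N -> agree_upto M N l -> agree_upto M N k.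
Proof.
rewrite /agree_upto /= => kl E.
by rewrite -(setIidl (word_ball_le kl)) -!setIA E.
Qed.

Lemma agree_maxP M N : marked_ker M <> marked_ker N ->
  agree_upto M N (agree_max M N) /\
  forall k, agree_upto M N k -> (k <= agree_max M N)%N.
Proof.
move=> neq; apply: (@xgetPex _ 0%N [set v | agree_upto M N v /\
  forall k, agree_upto M N k -> (k <= v)%N]).
have [K KP] : exists K, forall k, agree_upto M N k -> (k <= K)%N.
  apply: contrapT => nb; apply: neq.
  have all_k k : agree_upto M N k.
    apply: contrapT => nk; apply: nb; exists k => l al.
    by case: leqP => // /ltnW kl; case: nk; exact: agree_upto_le al.
  apply/seteqP; split=> u uk; have := all_k (size (fword u));
    rewrite /agree_upto /= => /seteqP[h1 h2].
  - by case: (h1 u) => //; split=> //; exists (fword u) => //; exact: word_val_fgen.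
  - by case: (h2 u) => //; split=> //; exists (fword u) => //; exact: word_val_fgen.
have ex : exists k, `[< agree_upto M N k >].
  by exists 0%N; apply/asboolP; exact: agree_upto0.
have bd k : `[< agree_upto M N k >] -> (k <= K)%N by move/asboolP; exact: KP.
case: (ex_maxnP ex bd) => v /asboolP av vmax; exists v; split=> // k ak.
by apply: vmax; apply/asboolP.
Qed.

Variable R : realType.
Local Notation dist := (@marked_dist R n).

Lemma marked_dist_ker M M' N N' : marked_ker M = marked_ker M' ->
  marked_ker N = marked_ker N' -> dist M N = dist M' N'.
Proof. by rewrite /marked_dist /agree_max /agree_upto => -> ->. Qed.

Lemma marked_dist_ge0 M N : (0 <= dist M N)%R.
Proof. by rewrite /marked_dist; case: ifP => // _; exact: expR_ge0. Qed.

Lemma marked_dist_eq0 M N : dist M N = 0%R <-> marked_iso M N.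
Proof.
rewrite marked_isoP /marked_dist; case: asboolP => // neq; split=> // /eqP.
by rewrite gt_eqF // expR_gt0.
Qed.

Lemma marked_dist_sym M N : dist M N = dist N M.
Proof.
rewrite /marked_dist (_ : (marked_ker M = marked_ker N) = (marked_ker N = marked_ker M)).
  by rewrite /agree_max (_ : agree_upto M N = agree_upto N M) //;
    apply/seteqP; split=> k /esym.
by apply/propext; split=> ->.
Qed.

Lemma marked_dist_ultra M N P :
  (dist M P <= dist M N)%R \/ (dist M P <= dist N P)%R.
Proof.
have [MN|MN] := pselect (marked_ker M = marked_ker N).
  by right; rewrite (marked_dist_ker MN (erefl _)).
have [NP|NP] := pselect (marked_ker N = marked_ker P).
  by left; rewrite (marked_dist_ker (erefl (marked_ker M)) NP).
have [MP|MP] := pselect (marked_ker M = marked_ker P).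
  by left; rewrite {1}/marked_dist asboolT //; exact: marked_dist_ge0.
rewrite /marked_dist !asboolF // !ler_expR !lerN2 !ler_nat.
have [a1 _] := agree_maxP MN; have [a2 _] := agree_maxP NP.
have [_ ub] := agree_maxP MP.
have trans k : agree_upto M N k -> agree_upto N P k -> agree_upto M P k.
  by rewrite /agree_upto /= => ->.
case: (leqP (agree_max M N) (agree_max N P)) => [le|/ltnW le]; [left|right].
  by apply: ub; apply: trans a1 _; exact: agree_upto_le a2.
by apply: ub; apply: trans a2; exact: agree_upto_le a1.
Qed.

Lemma marked_dist_triangle N M P : (dist M P <= dist M N + dist N P)%R.
Proof.
case: (marked_dist_ultra M N P) => /le_trans; apply.
  by rewrite lerDl marked_dist_ge0.
by rewrite lerDr marked_dist_ge0.
Qed.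

End MarkedGroups.

Definition marked_isob n : rel (marked_group n) :=
  fun M N => `[< marked_iso M N >].

Lemma marked_isob_refl n : reflexive (@marked_isob n).
Proof. by move=> M; apply/asboolP; exact: marked_iso_refl. Qed.

Lemma marked_isob_sym n : symmetric (@marked_isob n).
Proof. by move=> M N; apply/asboolP/asboolP; exact: marked_iso_sym. Qed.

Lemma marked_isob_trans n : transitive (@marked_isob n).
Proof.
move=> N M P /asboolP MN /asboolP NP; apply/asboolP.
exact: marked_iso_trans MN NP.
Qed.

Canonical marked_isob_equiv n := EquivRel (@marked_isob n)
  (@marked_isob_refl n) (@marked_isob_sym n) (@marked_isob_trans n).

Canonical marked_isob_encModRel n := defaultEncModRel (@marked_isob n).

(* Isomorphism classes of n-marked groups. The parameter R only records the
   field in which the metric takes its values. *)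
Definition marked_space (R : realType) (n : nat) : Type :=
  {eq_quot (@marked_isob n)}%qT.

HB.instance Definition _ R n := Choice.on (marked_space R n).

Definition marked_class (R : realType) n (M : marked_group n) :
  marked_space R n := \pi_({eq_quot (@marked_isob n)}%qT)%qT M.

Definition class_repr (R : realType) n (C : marked_space R n) : marked_group n :=
  repr (C : {eq_quot (@marked_isob n)}%qT).

Definition class_dist (R : realType) n (C D : marked_space R n) : R :=
  marked_dist R (class_repr C) (class_repr D).

Section MarkedSpace.
Variables (R : realType) (n : nat).
Implicit Types (C D E : marked_space R n) (M N : marked_group n).

Lemma class_reprK C : marked_class R (class_repr C) = C.
Proof. exact: reprK. Qed.

Lemma marked_classP M N : marked_class R M = marked_class R N <-> marked_iso M N.
Proof.
split=> [/eqquotP/asboolP //|iso].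
by apply/eqquotP; apply/asboolP.
Qed.

Lemma class_reprP M : marked_iso (class_repr (marked_class R M)) M.
Proof. by apply/marked_classP; rewrite class_reprK. Qed.

Lemma class_distE M N :
  class_dist (marked_class R M) (marked_class R N) = marked_dist R M N.
Proof. by apply: marked_dist_ker; apply/marked_isoP; exact: class_reprP. Qed.

Lemma class_distxx C : class_dist C C = 0%R.
Proof. by apply/marked_dist_eq0; exact: marked_iso_refl. Qed.

Lemma class_dist_positivity C D : class_dist C D = 0%R -> C = D.
Proof. by move/marked_dist_eq0/marked_classP; rewrite !class_reprK. Qed.

Lemma class_dist_sym C D : class_dist C D = class_dist D C.
Proof. exact: marked_dist_sym. Qed.

Lemma class_dist_triangle D C E :
  (class_dist C E <= class_dist C D + class_dist D E)%R.
Proof. exact: marked_dist_triangle. Qed.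

HB.instance Definition _ := isMetric.Build R (marked_space R n)
  class_distxx class_dist_positivity class_dist_sym class_dist_triangle.

End MarkedSpace.

(* N together with infinity, encoded as None. *)
Notation natinf := (option nat).

Definition natinf_ge (k : nat) (a : natinf) : bool :=
  if a is Some b then (k <= b)%N else true.

(* The product a b a ... with k alternating factors. *)
Fixpoint alt_prod (G : groupType) (a b : G) (k : nat) : G :=
  if k is k'.+1 then a * alt_prod b a k' else 1.

(* The diagonal values m i i are irrelevant. *)
Definition dyer_data n (f : 'I_n -> natinf) (m : 'I_n -> 'I_n -> natinf) : Prop :=
  (forall i, natinf_ge 2 (f i)) /\
  forall i j, i != j ->
    [/\ m i j = m j i, natinf_ge 2 (m i j) &
        natinf_ge 3 (f i) || natinf_ge 3 (f j) ->
        m i j = Some 2 \/ m i j = None].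

Definition dyer_relators n (f : 'I_n -> natinf) (m : 'I_n -> 'I_n -> natinf) :
    set (free_group n) :=
  [set r | exists i k, f i = Some k /\ r = fgen i ^+ k] `|`
  [set r | exists i j k, [/\ i != j, m i j = Some k &
    r = alt_prod (fgen i) (fgen j) k * (alt_prod (fgen j) (fgen i) k)^-1]].

Definition has_presentation n (M : marked_group n) (rels : set (free_group n)) :
  Prop := marked_ker M = normal_closure rels.

Definition is_marked_dyer n (M : marked_group n) : Prop :=
  exists (f : 'I_n -> natinf) (m : 'I_n -> 'I_n -> natinf),
    dyer_data f m /\ has_presentation M (dyer_relators f m).

Definition dyer_space (R : realType) (n : nat) : set (marked_space R n) :=
  [set marked_class R M | M in @is_marked_dyer n].

(* Main.v *)
Require Import Defs.
From HB Require Import structures.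
From mathcomp Require Import all_boot all_order all_algebra.
From mathcomp Require Import all_classical all_reals all_analysis.
From mathcomp Require Import lra.
From Stdlib Require Setoid Morphisms.

Set Implicit Arguments.
Unset Strict Implicit.
Unset Printing Implicit Defensive.

Import Order.TTheory GRing.Theory Num.Theory.

(* Let G be a limit of Dyer systems D_r with data (f_r, m_r). By compactness of
   N with infinity the data may be assumed to converge to Dyer data (f, m). The
   relators of (f, m) hold in G, so the point is that large exponents create no
   short relations: a word of length L that is trivial in D(f_r, m_r) is trivial
   in every group satisfying the relators whose exponents are at most 2L.

   The Dyer group is a subgroup of a Coxeter group, its semidirect product with
   the group (Z/2)^n of automorphisms that invert generators; this multiplies
   lengths by at most 2 and reduces the claim to Coxeter groups. There it follows
   from Matsumoto's argument, which by the exchange condition rewrites a word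
   without ever making it longer, hence only uses short braid relations. The
   geometric representation ensures that the order of a product of two
   generators is the one prescribed by the Coxeter matrix. *)

(** * Words in Coxeter groups *)

(** Locates the letter removed by an exchange: in the prefix [u] or in the remainder [r]. *)
Lemma cat_eq_cat_cons (T : Type) (u r w1 w2 : seq T) i :
  u ++ r = w1 ++ i :: w2 ->
  (exists w, u = w1 ++ i :: w /\ w2 = w ++ r) \/
  (exists w, r = w ++ i :: w2 /\ w1 = u ++ w).
Proof.
elim: u w1 => [|b u IH] [|c w1] //=; first by move=> ->; right; exists [::].
- by move=> ->; right; exists (c :: w1).
- by case=> -> <-; left; exists u.
case=> -> /IH[[w [-> ->]]|[w [-> ->]]]; first by left; exists w.
by right; exists w.
Qed.

Section AlternatingWords.
Variable J : Type.
Implicit Types (i j s t : J) (u v w : seq J).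

Fixpoint alt_word s t k : seq J :=
  if k is k'.+1 then s :: alt_word t s k' else [::].

Lemma size_alt_word s t k : size (alt_word s t k) = k.
Proof. by elim: k s t => //= k IH s t; rewrite IH. Qed.

Lemma alt_wordD s t k l : alt_word s t (k + l) =
  alt_word s t k ++ (if odd k then alt_word t s l else alt_word s t l).
Proof. by elim: k s t => //= k IH s t; rewrite IH; case: odd. Qed.

Lemma rev_alt_word s t k :
  rev (alt_word s t k) = if odd k then alt_word s t k else alt_word t s k.
Proof.
elim: k s t => //= k IH s t; rewrite rev_cons IH -cats1.
have E x y : alt_word x y k.+1 = alt_word x y k ++ [:: if odd k then y else x].
  by rewrite -addn1 alt_wordD; case: odd.
by have := E t s; have := E s t; rewrite /=; case: (odd k) => /= E1 E2; rewrite ?E1 ?E2.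
Qed.

Lemma rcons_alt_word s t k :
  rcons (alt_word s t k.*2) s = alt_word s t k.*2.+1.
Proof. by rewrite -addn1 alt_wordD odd_double cats1. Qed.

(** Removing an inner letter brings two equal letters together, and removing the first of several
    puts [t] next to the [t] in front; only removing the last letter leaves no square. *)
Lemma alt_word_delete s t k u i v : alt_word s t k = u ++ i :: v ->
  (v = [::] /\ t :: u = alt_word t s k) \/
  exists p j q, t :: u ++ v = p ++ [:: j, j & q].
Proof.
elim: k s t u => [|k IH] s t [|a u] //=.
  case=> _ <-; case: k {IH} => [|k] /=; first by left.
  by right; exists [::], t, (alt_word s t k).
case=> <- /IH[[-> <-]|[p [j [q E]]]]; first by left.
by right; exists (t :: p), j, q; rewrite /= E.
Qed.

Section Action.
Variables (X : Type) (a : J -> X -> X).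

Lemma foldr_alt_word_iter s t k x :
  foldr a x (alt_word s t k.*2) = iter k (fun y => a s (a t y)) x.
Proof. by elim: k x => //= k IH x; rewrite IH. Qed.

Hypothesis aK : forall j, involutive (a j).

Lemma foldr_rev w x : foldr a (foldr a x w) (rev w) = x.
Proof. by elim: w x => //= j w IH x; rewrite rev_cons -cats1 foldr_cat /= aK. Qed.

(** As generators act by involutions, [alt_word s t k.*2] acts as [alt_word s t k] times the inverse
    of [alt_word t s k]. *)
Lemma foldr_alt_wordC s t k :
  (forall x, foldr a x (alt_word s t k.*2) = x) <->
  (forall x, foldr a x (alt_word s t k) = foldr a x (alt_word t s k)).
Proof.
have E x : foldr a x (alt_word s t k.*2) =
    foldr a (foldr a x (rev (alt_word t s k))) (alt_word s t k).
  by rewrite -addnn alt_wordD foldr_cat rev_alt_word.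
split=> [id2 x|C x]; last first.
  by rewrite E C; have := foldr_rev (rev (alt_word t s k)) x; rewrite revK.
by rewrite -[in RHS](id2 (foldr a x (alt_word t s k))) E foldr_rev.
Qed.

Lemma foldr_alt_word_dvd s t m k : m %| k ->
  (forall x, foldr a x (alt_word s t m.*2) = x) ->
  forall x, foldr a x (alt_word s t k.*2) = x.
Proof.
case/dvdnP=> q -> E; elim: q => //= q IH x.
by rewrite mulSn doubleD alt_wordD odd_double foldr_cat IH E.
Qed.

End Action.
End AlternatingWords.

(** * Words and the exchange condition in a Coxeter group *)

Definition coxeter_matrix (J : eqType) (M : J -> J -> natinf) : Prop :=
  [/\ forall i, M i i = Some 1, forall i j, M i j = M j i &
      forall i j, i != j -> natinf_ge 2 (M i j)].

(* Equality in the Coxeter group of M; as M i i = Some 1, the relators with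
   i = j say that the generators are involutions. *)
Inductive cox_eq (J : Type) (M : J -> J -> natinf) : seq J -> seq J -> Prop :=
| cox_refl w : cox_eq M w w
| cox_sym u v : cox_eq M u v -> cox_eq M v u
| cox_trans v u w : cox_eq M u v -> cox_eq M v w -> cox_eq M u w
| cox_rel u v i j k : M i j = Some k ->
    cox_eq M (u ++ alt_word i j k.*2 ++ v) (u ++ v).

Section CoxeterWords.
Variables (J : eqType) (M : J -> J -> natinf).
Hypothesis M_cox : coxeter_matrix M.
Implicit Types (i j s t : J) (u v w r : seq J).
Local Notation "u ~~~ v" := (cox_eq M u v) (at level 70).

Lemma cox_eq_act (X : Type) (a : J -> X -> X) :
  (forall i j k, M i j = Some k -> forall x, foldr a x (alt_word i j k.*2) = x) ->
  forall u v, u ~~~ v -> forall x, foldr a x u = foldr a x v.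
Proof.
move=> aM u v; elim=> // [? ? ? _ IH1 _ IH2 x|{}u {}v i j k Mij x].
- by rewrite IH1 IH2.
- by rewrite !foldr_cat (aM _ _ _ Mij).
Qed.

Lemma cox_context p q u v : u ~~~ v -> p ++ u ++ q ~~~ p ++ v ++ q.
Proof.
elim=> [w|{}u {}v _|{}v {}u w _ IH1 _ IH2|{}u {}v i j k Mij].
- exact: cox_refl.
- exact: cox_sym.
- exact: cox_trans IH1 IH2.
- by have := cox_rel (p ++ u) (v ++ q) Mij; rewrite -!catA.
Qed.

#[local] Hint Resolve cox_refl : core.

#[local] Instance cox_equivalence : RelationClasses.Equivalence (cox_eq M).
Proof.
split; [exact: cox_refl | exact: cox_sym |].
by move=> u v w; exact: cox_trans.
Qed.

#[local] Instance cat_cox_proper :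
  Morphisms.Proper (Morphisms.respectful (cox_eq M)
    (Morphisms.respectful (cox_eq M) (cox_eq M))) (@cat J).
Proof.
move=> u u' uu' v v' vv'; apply: (cox_trans (v := u' ++ v)).
  exact: (cox_context [::] v uu').
by have := cox_context u' [::] vv'; rewrite !cats0.
Qed.

#[local] Instance cons_cox_proper j :
  Morphisms.Proper (Morphisms.respectful (cox_eq M) (cox_eq M)) (cons j).
Proof. by move=> u v uv; have := cox_context [:: j] [::] uv; rewrite !cats0. Qed.

Lemma cox_sq j w : [:: j, j & w] ~~~ w.
Proof. by case: M_cox => M1 _ _; exact: (cox_rel [::] w (M1 j)). Qed.

Lemma cox_cons_move j u v : j :: u ~~~ v <-> u ~~~ j :: v.
Proof. by split=> [<-|->]; rewrite cox_sq. Qed.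

Lemma cox_rev w : rev w ++ w ~~~ [::].
Proof.
elim: w => [|j w IH]; first exact: cox_refl.
by rewrite rev_cons -cats1 -catA /= cox_sq.
Qed.

Lemma cox_revr w : w ++ rev w ~~~ [::].
Proof. by rewrite -{1}[w]revK; exact: cox_rev. Qed.

Lemma cox_catIr w u v : u ++ w ~~~ v ++ w -> u ~~~ v.
Proof.
move=> E; rewrite -[u]cats0 -[v]cats0 -(cox_revr w) !catA.
by rewrite E.
Qed.

#[local] Instance rev_cox_proper :
  Morphisms.Proper (Morphisms.respectful (cox_eq M) (cox_eq M)) (@rev J).
Proof.
by move=> u v uv; apply: (@cox_catIr u); rewrite cox_rev uv cox_rev.
Qed.

Lemma cox_odd_size u v : u ~~~ v -> odd (size u) = odd (size v).
Proof.
elim=> // [? ? ? _ -> _ ->|{}u {}v i j k _] //.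
by rewrite !size_cat size_alt_word !oddD odd_double.
Qed.

Lemma cox_conj_cons j r u :
  j :: rcons r j ~~~ u <-> r ~~~ j :: rcons u j.
Proof.
rewrite cox_cons_move -!cats1; split=> [E|->]; last first.
  by rewrite /= -catA /= (cox_sq j [::]) cats0.
by apply: (@cox_catIr [:: j]); rewrite E /= -catA /= (cox_sq j [::]) cats0.
Qed.

(* The parity of the number of times the reflection r occurs among the
   reflections p j p^-1 attached to the prefixes (rcons p j) of w. *)
Fixpoint refl_parity w r : bool :=
  if w is j :: w' then `[< r ~~~ [:: j] >] (+) refl_parity w' (j :: rcons r j)
  else false.

Lemma refl_parity_eq w r r' : r ~~~ r' -> refl_parity w r = refl_parity w r'.
Proof.
elim: w r r' => //= j w IH r r' E; congr (_ (+) _); last first.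
  by apply: IH; rewrite -!cats1 E.
by apply: asbool_equiv_eq; rewrite E.
Qed.

Lemma refl_parity_cat u v r :
  refl_parity (u ++ v) r = refl_parity u r (+) refl_parity v (rev u ++ r ++ u).
Proof.
elim: u r => [|j u IH] r /=; first by rewrite cats0.
by rewrite IH addbA rev_cons -!cats1 -!catA /= -catA.
Qed.

Lemma refl_parity_alt i j L r :
  refl_parity (alt_word i j L) r =
  \big[addb/false]_(l < L) `[< r ~~~ alt_word i j l.*2.+1 >].
Proof.
elim: L i j r => [|L IH] i j r; first by rewrite big_ord0.
rewrite big_ord_recl /= IH; congr (_ (+) _); apply: eq_bigr => l _.
apply: asbool_equiv_eq; rewrite cox_conj_cons.
by rewrite add0n /= rcons_alt_word.
Qed.

(** The reflections at positions [l] and [k + l] differ by the relator itself, so each is counted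
    twice. *)
Lemma refl_parity_rel i j k r : M i j = Some k ->
  refl_parity (alt_word i j k.*2) r = false.
Proof.
move=> Mij; rewrite refl_parity_alt -addnn big_split_ord -[RHS](addbb
  (\big[addb/false]_(l < k) `[< r ~~~ alt_word i j l.*2.+1 >])).
congr (_ (+) _); apply: eq_bigr => l _; apply: asbool_equiv_eq.
have := cox_rel [::] (alt_word i j l.*2.+1) Mij; rewrite !cat0s => E.
have -> : (rshift k l).*2.+1 = k.*2 + l.*2.+1 by rewrite /= doubleD addnS.
by rewrite alt_wordD odd_double E.
Qed.

Lemma refl_parity_cox u v r : u ~~~ v -> refl_parity u r = refl_parity v r.
Proof.
move=> E; elim: E r => // [? ? ? _ IH1 _ IH2 r|{}u {}v i j k Mij r].
  by rewrite IH1 IH2.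
have r1 := cox_rel [::] [::] Mij; rewrite /= cats0 in r1.
rewrite !refl_parity_cat (refl_parity_rel _ Mij) addFb; congr (_ (+) _).
by apply: refl_parity_eq; rewrite r1 !cats0.
Qed.

(** An odd count means that r = p j p^-1 for some prefix [rcons p j] of [w]; multiplying [w] by r on
    the left then cancels this j. *)
Lemma refl_parity_delete w r : refl_parity w r ->
  exists u j v, w = u ++ j :: v /\ r ++ w ~~~ u ++ v.
Proof.
elim: w r => //= j w IH r; have [tj _|_ /=] := asboolP (r ~~~ [:: j]).
  by exists [::], j, w; split=> //; rewrite tj /= cox_sq.
move=> /IH[u [i [v [-> E]]]]; exists (j :: u), i, v; split=> //.
by rewrite /= -E /= cox_sq -cats1 -catA.
Qed.

Definition cox_reduced u : Prop := forall v, v ~~~ u -> size u <= size v.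

Lemma cox_reduced_exists w : exists2 u, cox_reduced u & u ~~~ w.
Proof.
have ex : exists k, `[< exists2 u, size u = k & u ~~~ w >].
  by exists (size w); apply/asboolP; exists w => //.
case: (ex_minnP ex) => k /asboolP[u <- uw] kmin; exists u => // v vu.
by apply: kmin; apply/asboolP; exists v => //; rewrite vu.
Qed.

Lemma cox_reduced_behead j u : cox_reduced (j :: u) -> cox_reduced u.
Proof. by move=> red v vu; have := red (j :: v); rewrite ltnS; apply; rewrite vu. Qed.

Lemma cox_reduced_size u v : cox_reduced u -> u ~~~ v -> size v <= size u ->
  cox_reduced v.
Proof. by move=> red uv le w wv; apply: leq_trans le (red _ _); rewrite wv uv. Qed.

Lemma cox_exchange j u v : cox_reduced (j :: u) -> j :: u ~~~ v ->
  exists v1 i v2, v = v1 ++ i :: v2 /\ u ~~~ v1 ++ v2.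
Proof.
move=> red E; have : refl_parity (j :: u) [:: j].
  rewrite /= asboolT; last by [].
  rewrite (refl_parity_eq u (cox_sq j [:: j])) addTb.
  (* An odd parity here would make [j :: u] equal to [u] with a letter removed, against minimality.
     So [[:: j]] has odd parity in [j :: u], hence in [v]. *)
  apply/negP => /refl_parity_delete[u1 [i [u2 [uE /cox_sym/red]]]].
  by rewrite uE /= !size_cat /= addnS ltnNge leqnSn.
rewrite (refl_parity_cox _ E) => /refl_parity_delete[v1 [i [v2 [vE vj]]]].
by exists v1, i, v2; split=> //; rewrite -vj -E /= cox_sq.
Qed.


(** * Matsumoto's theorem for words of bounded length *)

Section BoundedMatsumoto.
Variables (X : Type) (a : J -> X -> X) (L : nat).
Hypothesis aK : forall j, involutive (a j).
Hypothesis a_braid : forall i j k, k <= L ->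
  alt_word i j k ~~~ alt_word j i k ->
  forall x, foldr a x (alt_word i j k) = foldr a x (alt_word j i k).

Lemma not_cox_reduced_sq p j q : ~ cox_reduced (p ++ [:: j, j & q]).
Proof.
move=> red; have /red : p ++ q ~~~ p ++ [:: j, j & q] by rewrite cox_sq.
by rewrite !size_cat /= !addnS ltnNge leqnSn.
Qed.

Lemma cox_reduced_eq_size u v :
  cox_reduced u -> cox_reduced v -> u ~~~ v -> size u = size v.
Proof.
by move=> ru rv E; apply/eqP; rewrite eqn_leq ru ?rv //; exact: cox_sym.
Qed.

(* The alternating prefix of one of the two words is made longer and longer,
   until exchanging t removes the last letter of that prefix; this means that
   a braid relation between s and t applies. *)
Lemma matsumoto_step n : n < L ->
  (forall u v, size u = n -> cox_reduced u -> cox_reduced v -> u ~~~ v ->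
     forall x, foldr a x u = foldr a x v) ->
  forall d k s t r v, k + d = n -> size r = d ->
  cox_reduced (alt_word s t k.+1 ++ r) -> cox_reduced (t :: v) ->
  alt_word s t k.+1 ++ r ~~~ t :: v ->
  forall x, foldr a x (alt_word s t k.+1 ++ r) = foldr a x (t :: v).
Proof.
move=> nL IHn; elim/ltn_ind=> d IHd k s t r v kdn sr red redt E x.
have sv : size v = n.
  have := cox_reduced_eq_size red redt E.
  by rewrite size_cat size_alt_word sr addSn kdn => -[].
have redv := cox_reduced_behead redt.
have [w1 [i [w2 [wE vE]]]] := cox_exchange redt (cox_sym E).
have sw : size (w1 ++ w2) = n.
  have := congr1 size wE.
  by rewrite !size_cat size_alt_word sr addSn kdn /= addnS => -[].
have red12 : cox_reduced (w1 ++ w2) by apply: cox_reduced_size vE _; rewrite // sv sw.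
have tE : t :: v ~~~ t :: w1 ++ w2 by rewrite vE.
have redt12 : cox_reduced (t :: w1 ++ w2).
  by apply: cox_reduced_size tE _; rewrite //= sv sw.
have -> : foldr a x (t :: v) = foldr a x (t :: w1 ++ w2).
  by rewrite /=; congr (a t _); exact: IHn.
case: (cat_eq_cat_cons wE) => [[w [altE w2E]]|[w [rE w1E]]].
  rewrite w2E in tE redt12 *.
  case: (alt_word_delete altE) => [[w0 E0]|[p [j [q E0]]]]; last first.
    by case: (@not_cox_reduced_sq p j (q ++ r)); rewrite catA -cat_cons E0
      -catA in redt12.
  rewrite w0 cat0s in tE *.
  rewrite -cat_cons E0 !foldr_cat; apply: a_braid.
    by apply: leq_trans nL; rewrite ltnS -kdn leq_addr.
  by apply: (@cox_catIr r); rewrite E tE -cat_cons E0.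
(* The exchange takes place in the remainder: [t] extends the alternating prefix and the remainder
   is one letter shorter. The induction applies with [s] and [t], and the two words,
   interchanged. *)
rewrite w1E in tE sw red12 redt12 *; rewrite -catA in tE sw red12 redt12 *.
symmetry; apply: (IHd (size (w ++ w2)) _ k.+1 t s (w ++ w2)) => //.
- by rewrite -sr rE !size_cat /= addnS.
- by rewrite addSn; move: sw; rewrite size_cat size_alt_word addSn.
exact: cox_trans (cox_sym tE) (cox_sym E).
Qed.

Lemma matsumoto u v : size u <= L -> cox_reduced u -> cox_reduced v ->
  u ~~~ v -> forall x, foldr a x u = foldr a x v.
Proof.
move: {2}(size u) (erefl (size u)) => n; elim: n u v => [|n IH] u v su uL ru rv E x.
  have := cox_reduced_eq_size ru rv E; rewrite su.
  by move/size0nil: su => -> /esym/size0nil ->.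
have := cox_reduced_eq_size ru rv E; rewrite su; move: uL; rewrite su => nL.
case: u su ru E => // s u [su] ru E; case: v rv E => // t v rv E _.
apply: (matsumoto_step nL _ (k := 0) (r := u)) su _ _ _ _ => //.
by move=> u' v' su'; apply: IH; rewrite ?su' // ltnW.
Qed.

(** Letters are added on the left. If [j :: u] is not reduced, its reduced form [v] is shorter than
    [u], so [j :: v] is another reduced word for [u], with the same action by [matsumoto]; then
    [j :: u] acts as [v]. No word compared is longer than [w]. *)
Lemma cox_reduce_act w : size w <= L ->
  exists u, [/\ cox_reduced u, u ~~~ w, size u <= size w &
    forall x, foldr a x u = foldr a x w].
Proof.
elim: w => [|j w IH] sw; first by exists [::].
have [u [ru uw su actu]] := IH (ltnW sw).
have [rju|nrju] := pselect (cox_reduced (j :: u)).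
  by exists (j :: u); split=> // [|x /=]; rewrite ?uw ?actu.
have [v rv vju] := cox_reduced_exists (j :: u).
have jvu : j :: v ~~~ u by rewrite vju cox_sq.
have svu : size v < size u.
  have le : size v <= size u.
    rewrite leqNgt; apply/negP => gt; apply: nrju.
    exact: cox_reduced_size rv vju gt.
  (* Relators have even length, so the parity of the length excludes equality. *)
  rewrite ltn_neqAle le andbT; apply/eqP => Es.
  by have := cox_odd_size vju; rewrite Es /=; case: odd.
have rjv : cox_reduced (j :: v) by apply: cox_reduced_size (cox_sym jvu) svu.
exists v; split=> //.
- by rewrite vju uw.
- by apply: ltnW; apply: leq_trans svu _; exact: leq_trans su _.
move=> x; rewrite /= -actu -(matsumoto _ rjv ru jvu) /= ?aK //.
by apply: leq_trans svu _; apply: leq_trans su _; exact: ltnW.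
Qed.

Lemma cox_eq_nil_act w : size w <= L -> w ~~~ [::] ->
  forall x, foldr a x w = x.
Proof.
move=> sw w1; have [u [ru uw _ actu]] := cox_reduce_act sw; move=> x.
by rewrite -actu; have /ru := cox_sym (cox_trans uw w1); case: (u).
Qed.

End BoundedMatsumoto.
End CoxeterWords.

(** * Orders of products of generators *)

Section Chebyshev.
Local Open Scope ring_scope.
Variable R : realType.

(** Chebyshev polynomials of the second kind, with shifted index: the value at [k] is
    U_(k-1)(c/2). *)
Fixpoint chebyshevU (c : R) (k : nat) : R :=
  match k with
  | 0 => 0
  | 1 => 1
  | (k''.+1 as k').+1 => c * chebyshevU c k' - chebyshevU c k''
  end.

Lemma chebyshevUSS c k :
  chebyshevU c k.+2 = c * chebyshevU c k.+1 - chebyshevU c k.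
Proof. by []. Qed.

(** The angle 0, corresponding to an infinite entry of the Coxeter matrix. *)
Lemma chebyshevU_2 k : chebyshevU 2 k = k%:R.
Proof.
suff [] : chebyshevU 2 k = k%:R /\ chebyshevU 2 k.+1 = k.+1%:R by [].
elim: k => [|k [IH1 IH2]] //; split=> //.
by rewrite chebyshevUSS IH1 IH2 -!natr1; lra.
Qed.

Lemma chebyshevU_cos (th : R) k :
  chebyshevU (cos th *+ 2) k * sin th = sin (k%:R * th).
Proof.
set U := chebyshevU _; suff [] : U k * sin th = sin (k%:R * th) /\
  U k.+1 * sin th = sin (k.+1%:R * th) by [].
elim: k => [|k [IH1 IH2]]; first by rewrite /U /= !mul0r sin0 !mul1r.
split=> //; rewrite /U chebyshevUSS mulrBl -/(U k) -/(U k.+1) -mulrA IH1 IH2.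
have -> : k%:R * th = k.+1%:R * th - th by rewrite -natr1; lra.
have -> : k.+2%:R * th = k.+1%:R * th + th by rewrite -(natr1 k.+1); lra.
by rewrite sinB sinD; lra.
Qed.

Variable m : nat.
Hypothesis m_ge2 : (2 <= m)%N.
Local Notation th := (pi / m%:R : R).
Local Notation U := (chebyshevU (cos th *+ 2)).

Let m_neq0 : m%:R != 0 :> R.
Proof. by rewrite pnatr_eq0; case: (m) m_ge2. Qed.

Lemma sin_pi_div_gt0 k : (0 < k < m)%N -> 0 < sin (k%:R * th).
Proof.
case/andP=> k0 km; have m0 : 0 < m%:R :> R by rewrite ltr0n (leq_trans _ m_ge2).
apply: sin_gt0_pi; rewrite mulr_gt0 ?ltr0n ?divr_gt0 ?pi_gt0 //=.
by rewrite mulrCA gtr_pMr ?pi_gt0 // ltr_pdivrMr // mul1r ltr_nat.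
Qed.

Lemma sin_pi_div_neq0 : sin th != 0.
Proof. by have := @sin_pi_div_gt0 1; rewrite mul1r m_ge2 => /(_ isT) h; rewrite gt_eqF. Qed.

Lemma chebyshevU_period k : U (m.*2 + k) = U k.
Proof.
apply: (mulIf sin_pi_div_neq0); rewrite !chebyshevU_cos.
rewrite -[RHS](sinD2pi (k%:R * th)); congr sin.
by rewrite natrD mulrDl addrC -mul2n natrM -mulrA [m%:R * _]mulrC divfK ?mulr_natl.
Qed.

(** For r = k mod m the hypotheses read sin(2r th) = 0 and sin((2r+1) th) = sin th. Hence cos(2r th)
    = 1 and sin(r th) = 0, impossible for 0 < r < m. *)
Lemma chebyshevU_order k : U k.*2 = 0 -> U k.*2.+1 = 1 -> (m %| k)%N.
Proof.
have UE q r : U (m.*2 * q + r) = U r.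
  by elim: q => [|q IH]; rewrite ?muln0 // mulnS -addnA chebyshevU_period.
have -> : k.*2 = (m.*2 * (k %/ m) + (k %% m).*2)%N.
  by rewrite {1}(divn_eq k m) doubleD mulnC doubleMl.
rewrite -addnS !UE /dvdn.
set r := (k %% m)%N => U0 U1; apply/negPn/negP; rewrite -lt0n => r0.
have := @sin_pi_div_gt0 r; rewrite r0 ltn_mod (leq_trans _ m_ge2) // => /(_ isT).
have S0 := chebyshevU_cos th r.*2; have S1 := chebyshevU_cos th r.*2.+1.
rewrite U0 mul0r in S0; rewrite U1 mul1r in S1.
have th1 : r.*2.+1%:R * th = r.*2%:R * th + th by rewrite -natr1 mulrDl mul1r.
rewrite th1 sinD -S0 mul0r add0r -{1}[sin th]mul1r in S1.
move/(mulIf sin_pi_div_neq0)/esym: S1.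
rewrite -mul2n natrM -mulrA mulr_natl cos_mulr2n => C.
have := sin2cos2 (r%:R * th); have -> : cos (r%:R * th) ^+ 2 = 1 by lra.
by rewrite subrr => /eqP; rewrite sqrf_eq0 => /eqP ->; rewrite ltxx.
Qed.

End Chebyshev.

(** * The geometric representation *)

Section GeometricRepresentation.
Local Open Scope ring_scope.
Variables (R : realType) (J : eqType) (M : J -> J -> natinf).
Hypothesis M_cox : coxeter_matrix M.
Implicit Types (i j s t : J) (x : J -> R).

(** Minus twice the canonical bilinear form on simple roots; an infinite entry gets the limit value
    2. *)
Definition cox_cos i j : R := if M i j is Some k then cos (pi / k%:R) *+ 2 else 2.

Lemma cox_cos_sym i j : cox_cos i j = cox_cos j i.
Proof. by case: M_cox => _ Msym _; rewrite /cox_cos Msym. Qed.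

Lemma cox_cos_diag i : cox_cos i i = -2.
Proof. by case: M_cox => M1 _ _; rewrite /cox_cos M1 divr1 cospi; lra. Qed.

(** The contragredient representation: [x l] is the value of a linear form on the simple root of
    index [l]. *)
Definition geom_refl i x : J -> R := fun l => x l + cox_cos i l * x i.

Lemma geom_reflK i : involutive (geom_refl i).
Proof.
by move=> x; apply/funext => l; rewrite /geom_refl cox_cos_diag; lra.
Qed.

(** For distinct [s] and [t], the value of the form [x] on the roots of the dihedral subsystem they
    generate. *)
Definition fired s t x k : R :=
  chebyshevU (cox_cos s t) k.+1 * x t + chebyshevU (cox_cos s t) k * x s.

Lemma firedSS s t x k :
  fired s t x k.+2 = cox_cos s t * fired s t x k.+1 - fired s t x k.
Proof. by rewrite /fired !chebyshevUSS; lra. Qed.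

(* The letters of the word act by adding multiples of fired s t x 0,
   fired s t x 1, and so on, alternately in the directions t and s. *)
Lemma geom_refl_alt s t x k :
  let y := foldr geom_refl x (alt_word s t k.*2) in
  [/\ y t = fired s t x k.*2, y s + cox_cos s t * y t = fired s t x k.*2.+1 &
   forall l, y l = x l + cox_cos t l * (\sum_(q < k) fired s t x q.*2)
                       + cox_cos s l * (\sum_(q < k) fired s t x q.*2.+1)].
Proof.
rewrite /= foldr_alt_word_iter; elim: k => [|k [IHt IHs IHl]] /=.
  split=> [||l]; rewrite ?big_ord0 /fired /=; lra.
move: (iter k _ x) IHt IHs IHl => y yt ys yl.
have cts := cox_cos_sym t s.
have ztE : geom_refl t y t = - fired s t x k.*2.
  by rewrite /geom_refl cox_cos_diag -yt; lra.
have zsE : geom_refl t y s = fired s t x k.*2.+1.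
  by rewrite /geom_refl cts -ys.
have tE : geom_refl s (geom_refl t y) t = fired s t x k.*2.+2.
  by rewrite firedSS -zsE {1}/geom_refl ztE; lra.
split=> // [|l].
  rewrite tE doubleS [in RHS]firedSS -zsE {1}/geom_refl cox_cos_diag; lra.
rewrite {1}/geom_refl zsE /geom_refl yt yl !big_ord_recr /=; lra.
Qed.

(** For s and t distinct, the sums Z and O of the even and odd terms over a period satisfy 2Z = cO
    and 2O = cZ by the recurrence. As c^2 differs from 4, both vanish. *)
Lemma geom_refl_rel s t k x : M s t = Some k ->
  foldr geom_refl x (alt_word s t k.*2) = x.
Proof.
have [<-|st] := eqVneq s t.
  by case: M_cox => -> _ _ [<-] /=; exact: geom_reflK.
move=> Mst; case: M_cox => _ _ /(_ _ _ st); rewrite Mst /= => k2.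
have cE : cox_cos s t = cos (pi / k%:R) *+ 2 by rewrite /cox_cos Mst.
have per l : fired s t x (k.*2 + l) = fired s t x l.
  by rewrite /fired -addnS cE !(chebyshevU_period R k2).
set y := fired s t x in per *; apply/funext => l.
have [_ _ ->] := geom_refl_alt s t x k; rewrite -/y.
set Z := \sum_(q < k) y q.*2; set O := \sum_(q < k) y q.*2.+1.
have shiftZ : \sum_(q < k) y q.+1.*2 = Z.
  apply: (addrI (y 0)); rewrite -[LHS](big_ord_recl k (fun q => y q.*2)).
  by rewrite big_ord_recr /= -[k.*2]addn0 per addrC.
have shiftO : \sum_(q < k) y q.+1.*2.+1 = O.
  apply: (addrI (y 1)); rewrite -[LHS](big_ord_recl k (fun q => y q.*2.+1)).
  by rewrite big_ord_recr /= -[k.*2.+1]addn1 per addrC.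
have ZO : Z *+ 2 = cox_cos s t * O.
  rewrite mulr2n -{1}shiftZ -big_split mulr_sumr; apply: eq_bigr => q _ /=.
  by rewrite doubleS /y firedSS; lra.
have OZ : O *+ 2 = cox_cos s t * Z.
  rewrite mulr2n -{1}shiftO -shiftZ -big_split mulr_sumr.
  by apply: eq_bigr => q _ /=; rewrite doubleS /y (firedSS _ _ _ q.*2.+1); lra.
have c4 : 4 - cox_cos s t ^+ 2 != 0.
  have -> : 4 - cox_cos s t ^+ 2 = 4 * sin (pi / k%:R) ^+ 2.
    by rewrite cE sin2cos2; lra.
  by rewrite mulf_neq0 ?pnatr_eq0 // expf_neq0 // sin_pi_div_neq0.
have cZO := congr1 ( *%R (cox_cos s t)) ZO.
have cOZ := congr1 ( *%R (cox_cos s t)) OZ.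
have Z0 : Z = 0 by apply: (mulfI c4); rewrite mulr0; lra.
have O0 : O = 0 by apply: (mulfI c4); rewrite mulr0; lra.
by rewrite Z0 O0 !mulr0 !addr0.
Qed.

(** The indicator functions of [s] and [t] give U_(2k) = 0 and U_(2k+1) = 1 in the notation of
    [chebyshevU]. For an infinite entry U_(2k) = 2k is nonzero. *)
Lemma cox_alt_order s t k : s != t -> (0 < k)%N ->
  cox_eq M (alt_word s t k) (alt_word t s k) ->
  exists2 m, M s t = Some m & (m %| k)%N.
Proof.
move=> st k0 E.
have /(foldr_alt_wordC geom_reflK) id2k :=
  cox_eq_act (fun i j k Mij x => @geom_refl_rel i j k x Mij) E.
have yE x : fired s t x k.*2 = x t by have [<- _ _] := geom_refl_alt s t x k; rewrite id2k.
have U0 : chebyshevU (cox_cos s t) k.*2 = 0.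
  have := yE (fun l => (l == s)%:R); rewrite /fired eqxx [t == s]eq_sym.
  by rewrite (negbTE st) mulr0 mulr1 add0r.
have U1 : chebyshevU (cox_cos s t) k.*2.+1 = 1.
  have := yE (fun l => (l == t)%:R); rewrite /fired eqxx (negbTE st).
  by rewrite mulr0 mulr1 addr0.
case: M_cox => _ _ /(_ _ _ st); move: U0 U1; rewrite /cox_cos.
case: (M s t) => [m U0 U1 m2|/eqP]; first by exists m => //; exact: chebyshevU_order U0 U1.
by rewrite chebyshevU_2 pnatr_eq0 double_eq0 (gtn_eqF k0).
Qed.

End GeometricRepresentation.

(** A braid relation of length k between distinct generators forces a matrix entry dividing k. If k
    <= L this entry is at most [L], so short relators supply every braid relation that Matsumoto's
    argument uses. *)
Lemma cox_trivial_act (R : realType) (J : eqType) (M : J -> J -> natinf)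
    (X : Type) (a : J -> X -> X) (L : nat) :
  coxeter_matrix M -> 0 < L ->
  (forall i j k, k <= L -> M i j = Some k ->
     forall x, foldr a x (alt_word i j k.*2) = x) ->
  forall w, size w <= L -> cox_eq M w [::] -> forall x, foldr a x w = x.
Proof.
move=> Mc L0 aM; have [M1 _ _] := Mc.
have aK j : involutive (a j) by move=> x; exact: (aM j j 1 L0 (M1 j) x).
apply: (cox_eq_nil_act Mc aK) => i j [|k] kL E //.
have [-> //|ij] := eqVneq i j.
have [m Mij mk] := cox_alt_order R Mc ij (ltn0Sn k) E.
apply/(foldr_alt_wordC aK); apply: (foldr_alt_word_dvd mk); apply: aM => //.
exact: leq_trans (dvdn_leq _ mk) kL.
Qed.

(** * Presented groups *)

Section Presentations.
Local Open Scope group_scope.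
Local Open Scope classical_set_scope.

Lemma normal_closure_normal (G : groupType) (A : set G) :
  is_normal_subgroup (normal_closure A).
Proof.
split; first split.
- by move=> H [[[]]].
- by move=> x y Kx Ky H HA; case: (HA) => -[[_ HM _] _] _; apply: HM; [apply: Kx|apply: Ky].
- by move=> x Kx H HA; case: (HA) => -[[_ _ HV] _] _; apply: HV; apply: Kx.
- by move=> x g Kx H HA; case: (HA) => -[_ HJ] _; apply: HJ; apply: Kx.
Qed.

Lemma sub_normal_closure (G : groupType) (A : set G) : A `<=` normal_closure A.
Proof. by move=> x Ax H [_]; apply. Qed.

Lemma normal_closure_sub (G : groupType) (A H : set G) :
  is_normal_subgroup H -> A `<=` H -> normal_closure A `<=` H.
Proof. by move=> nH AH x; apply. Qed.

Lemma morph_ker_normal (G H : groupType) (p : G -> H) :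
  {morph p : x y / x * y} -> is_normal_subgroup [set x | p x = 1].
Proof.
move=> pM; have p1 : p 1 = 1 by apply: (mulgI (p 1)); rewrite -pM !mulg1.
have pV x : p x^-1 = (p x)^-1 by apply: (mulIg (p x)); rewrite -pM !mulVg.
split; first split=> //= [x y|x] => [xK yK|xK]; rewrite ?pM ?pV ?xK ?yK ?mulg1 ?invg1 //.
by move=> x g /= xK; rewrite /conjg !pM pV xK mul1g mulVg.
Qed.

(** The carrier consists of chosen coset representatives, the values of [rep]. *)
Lemma quotient_group_exists (G : groupType) (K : set G) :
  is_normal_subgroup K ->
  exists (H : groupType) (p : G -> H),
    [/\ {morph p : x y / x * y}, forall y, exists x, p x = y &
        forall x, p x = 1 <-> K x].
Proof.
case=> -[K1 KM KV] KJ.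
have KC x y : K (x * y) -> K (y * x).
  by move=> /(KJ _ x); rewrite /conjg mulgA mulKg.
pose rep x := xget 1 [set y | K (x^-1 * y)].
have repK x : K (x^-1 * rep x).
  by apply: (@xgetPex _ 1 [set y | K (x^-1 * y)]); exists x; rewrite /= mulVg.
have repE x y : K (x^-1 * y) -> rep x = rep y.
  move=> Kxy; congr (xget 1 _); apply/seteqP; split=> z /= Kz.
    have -> : y^-1 * z = (x^-1 * y)^-1 * (x^-1 * z).
      by rewrite invgM invgK -mulgA mulVKg.
    by apply: KM => //; exact: KV.
  have -> : x^-1 * z = (x^-1 * y) * (y^-1 * z) by rewrite -mulgA mulVKg.
  exact: KM.
have repI x : rep (rep x) = rep x by apply/esym/repE/repK.
pose T := {x : G | rep x == x}.
pose pr x : T := exist (fun x => rep x == x) (rep x) (introT eqP (repI x)).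
have prE x y : K (x^-1 * y) -> pr x = pr y by move=> /repE E; apply: val_inj.
have prK (t : T) : pr (val t) = t by apply: val_inj; exact/eqP/(valP t).
have Kpr x : K (x^-1 * val (pr x)) by exact: repK.
pose mulT (s t : T) := pr (val s * val t); pose invT (t : T) := pr (val t)^-1.
have mulE x y : mulT (pr x) (pr y) = pr (x * y).
  apply/esym/prE; rewrite invgM -mulgA; apply/KC.
  have -> : x^-1 * (val (pr x) * val (pr y)) * y^-1 =
    (x^-1 * val (pr x)) * (val (pr y) * y^-1) by rewrite !mulgA.
  by apply: KM => //; exact: KC.
have invE x : invT (pr x) = pr x^-1.
  apply/esym/prE; rewrite invgK.
  have -> : x * (val (pr x))^-1 = (val (pr x) * x^-1)^-1 by rewrite invgM invgK.
  by apply: KV; apply: KC.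
have mulA : associative mulT.
  by move=> x y z; rewrite -[x]prK -[y]prK -[z]prK !mulE mulgA.
have mul1 : left_id (pr 1) mulT by move=> x; rewrite -[x]prK mulE mul1g.
have mulr1 : right_id (pr 1) mulT by move=> x; rewrite -[x]prK mulE mulg1.
have mulV : left_inverse (pr 1) invT mulT.
  by move=> x; rewrite -[x]prK invE mulE mulVg.
have mulrV : right_inverse (pr 1) invT mulT.
  by move=> x; rewrite -[x]prK invE mulE mulgV.
pose H : groupType := HB.pack T (isGroup.Build T mulA mul1 mulr1 mulV mulrV).
exists H, pr; split=> [x y|y|x].
- by rewrite -mulE.
- by exists (val y); exact: prK.
split=> [/(congr1 val) /= E|Kx]; last by apply/esym/prE; rewrite invg1 mul1g.
have -> : x = (1^-1 * rep 1) * (x^-1 * rep x)^-1.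
  by rewrite E invg1 mul1g invgM invgK mulVKg.
by apply: KM => //; apply: KV.
Qed.

Variable n : nat.

Lemma free_lift_unique (H : groupType) (p : free_group n -> H) :
  {morph p : u v / u * v} -> forall u, p u = free_lift (fun i => p (fgen i)) u.
Proof.
move=> pM u; have p1 : p 1 = 1 by apply: (mulgI (p 1)); rewrite -pM !mulg1.
have pV x : p x^-1 = (p x)^-1 by apply: (mulIg (p x)); rewrite -pM !mulVg.
rewrite -{1}[u]word_val_fgen /free_lift /word_val (big_morph p pM p1).
by apply: eq_bigr => -[i []] _; rewrite /letter_val /= ?pV.
Qed.

Lemma morph_free_lift (H H' : groupType) (h : 'I_n -> H) (p : H -> H') :
  {morph p : x y / x * y} ->
  forall u, p (free_lift h u) = free_lift (fun i => p (h i)) u.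
Proof.
move=> pM u.
have phM : {morph p \o free_lift h : u v / u * v}.
  by move=> x y; rewrite /= free_liftM pM.
rewrite [LHS](free_lift_unique phM); congr (free_lift _ u).
by apply/funext => i /=; rewrite free_lift_gen.
Qed.

Lemma free_lift_alt_prod (H : groupType) (h : 'I_n -> H) u v k :
  free_lift h (alt_prod u v k) = alt_prod (free_lift h u) (free_lift h v) k.
Proof. by elim: k u v => [|k IH] u v /=; rewrite ?free_lift1 // free_liftM IH. Qed.

Lemma free_liftX (H : groupType) (h : 'I_n -> H) u k :
  free_lift h (u ^+ k) = free_lift h u ^+ k.
Proof. by elim: k => [|k IH]; rewrite ?free_lift1 // !expgS free_liftM IH. Qed.

Lemma dyer_relators_ker (H : groupType) (h : 'I_n -> H) f m :
  (dyer_relators f m `<=` [set u | free_lift h u = 1]) <->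
  (forall i k, f i = Some k -> h i ^+ k = 1) /\
  (forall i j k, i != j -> m i j = Some k ->
     alt_prod (h i) (h j) k = alt_prod (h j) (h i) k).
Proof.
split=> [rel|[relf relm] u [[i [k [fi ->]]]|[i [j [k [ij mij ->]]]]]].
- split=> [i k fi|i j k ij mij].
    rewrite -(free_lift_gen h i) -free_liftX.
    by apply: rel; left; exists i, k.
  have /= := rel (alt_prod (fgen i) (fgen j) k * (alt_prod (fgen j) (fgen i) k)^-1).
  rewrite free_liftM free_liftV !free_lift_alt_prod !free_lift_gen => E.
  by apply: (mulIg (alt_prod (h j) (h i) k)^-1); rewrite mulgV E //; right; exists i, j, k.
- by rewrite /= free_liftX free_lift_gen relf.
- rewrite /= free_liftM free_liftV !free_lift_alt_prod !free_lift_gen.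
  by rewrite (relm i j) // mulgV.
Qed.

End Presentations.

(** * Dyer groups in Coxeter groups *)

(* The Coxeter group of this matrix is the semidirect product of the Dyer group
   with the group (Z/2)^n whose i-th generator iota_i inverts s_i and fixes the
   other s_j: (i, false) stands for iota_i and (i, true) for iota_i s_i. When
   f i = Some 2, iota_i is a central direct factor instead and (i, true)
   stands for s_i. *)
Definition dyer_matrix n (f : 'I_n -> natinf) (m : 'I_n -> 'I_n -> natinf)
    (p q : 'I_n * bool) : natinf :=
  if p.1 == q.1 then if p.2 == q.2 then Some 1 else f p.1
  else if p.2 && q.2 then m p.1 q.1 else Some 2.

(** Writes s_i as iota_i times iota_i s_i, and its inverse as the reversed word; a generator of
    order 2 is a single letter. *)
Definition dyer_letter n (f : 'I_n -> natinf) (a : letter n) :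
    seq ('I_n * bool) :=
  if f a.1 == Some 2 then [:: (a.1, true)]
  else if a.2 then [:: (a.1, true); (a.1, false)]
  else [:: (a.1, false); (a.1, true)].

Definition dyer_word n (f : 'I_n -> natinf) (w : seq (letter n)) :
    seq ('I_n * bool) :=
  flatten (map (dyer_letter f) w).

Section DyerCoxeter.
Variables (n : nat) (f : 'I_n -> natinf) (m : 'I_n -> 'I_n -> natinf).
Hypothesis fm : dyer_data f m.
Local Notation M := (dyer_matrix f m).
Local Notation "u ~~~ v" := (cox_eq M u v) (at level 70).
#[local] Hint Resolve cox_refl : core.
#[local] Existing Instances cox_equivalence cat_cox_proper cons_cox_proper.

Lemma natinf_ge3 i : f i != Some 2 -> natinf_ge 3 (f i).
Proof.
case: fm => /(_ i) + _; case: (f i) => //= k; rewrite leq_eqVlt.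
by case/orP=> [/eqP <-|//].
Qed.

Lemma dyer_data_commute i j k : i != j -> m i j = Some k ->
  ~~ ((f i == Some 2) && (f j == Some 2)) -> k = 2.
Proof.
case: fm => _ /(_ i j) + ij mij; rewrite negb_and => /(_ ij)[_ _ +] f2.
rewrite mij; case=> [|[]//|//].
by apply/orP; case/orP: f2 => /natinf_ge3; [left|right].
Qed.

Lemma dyer_matrix_cox : coxeter_matrix M.
Proof.
case: (fm) => f2 m2; split=> [p|[i b] [j c]|[i b] [j c]]; rewrite /dyer_matrix /=.
- by rewrite !eqxx.
- rewrite [j == i]eq_sym; have [->|ij] := eqVneq i j.
    by rewrite [c == b]eq_sym.
  by rewrite andbC; case: ifP => // _; case: (m2 _ _ ij).
have [->|ij] := eqVneq i j; first by rewrite xpair_eqE eqxx /= => /negbTE ->.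
by move=> _; case: ifP => // _; case: (m2 _ _ ij).
Qed.

Lemma size_dyer_word w : size (dyer_word f w) <= (size w).*2.
Proof.
elim: w => //= a w IH; rewrite /dyer_word /= size_cat doubleS -add2n.
by apply: leq_add => //; rewrite /dyer_letter; case: ifP => // _; case: ifP.
Qed.

Lemma dyer_letterV a : dyer_letter f (linv a) = rev (dyer_letter f a).
Proof. by case: a => i []; rewrite /dyer_letter /=; case: ifP. Qed.

Lemma dyer_word_winv w : dyer_word f (winv w) = rev (dyer_word f w).
Proof.
elim: w => //= a w IH; rewrite /dyer_word /winv /= rev_cons map_rcons.
by rewrite flatten_rcons dyer_letterV rev_cat -IH.
Qed.

Lemma dyer_word_lpush a w :
  dyer_word f (lpush a w) ~~~ dyer_letter f a ++ dyer_word f w.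
Proof.
case: w => [|b w] //=; case: eqP => [->|_] //.
rewrite /dyer_word /= dyer_letterV catA.
by rewrite (cox_revr dyer_matrix_cox).
Qed.

Lemma dyer_wordM (u v : free_group n) :
  dyer_word f (fword (u * v)%g) ~~~ dyer_word f (fword u) ++ dyer_word f (fword v).
Proof.
rewrite /=; elim: (fword u) => //= a w IH.
by rewrite dyer_word_lpush IH /dyer_word /= catA.
Qed.

Lemma cox_cons_swap p q w : M p q = Some 2 -> [:: p, q & w] ~~~ [:: q, p & w].
Proof.
move=> Mpq; have Mc := dyer_matrix_cox.
have := cox_rel [::] [:: q, p & w] Mpq; rewrite /= => <-.
by rewrite (cox_sq Mc) (cox_sq Mc).
Qed.

Lemma cox_cat_swap u v : (forall p q, p \in u -> q \in v -> M p q = Some 2) ->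
  u ++ v ~~~ v ++ u.
Proof.
elim: u => [|p u IH] uv; first by rewrite cats0.
rewrite /= IH; last by move=> a b au; apply: uv; rewrite inE au orbT.
elim: v {IH} uv => [|q v IH] //= uv.
rewrite cox_cons_swap ?IH ?uv ?mem_head // => a b au bv.
by apply: uv; rewrite // inE bv orbT.
Qed.

Lemma mem_dyer_letter a p : p \in dyer_letter f a -> p.1 = a.1.
Proof.
rewrite /dyer_letter; case: ifP => _; first by rewrite !inE => /eqP->.
by case: ifP => _; rewrite !inE => /orP[]/eqP->.
Qed.

Lemma dyer_word_alt_prod i j k : f i = Some 2 -> f j = Some 2 ->
  dyer_word f (fword (alt_prod (fgen i) (fgen j) k)) ~~~
  alt_word (i, true) (j, true) k.
Proof.
elim: k i j => [|k IH] i j fi fj //; rewrite [alt_prod _ _ _]/= dyer_wordM IH //.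
by rewrite /dyer_word /= /dyer_letter /= fi eqxx.
Qed.

Lemma dyer_word_normal :
  is_normal_subgroup [set u : free_group n | dyer_word f (fword u) ~~~ [::]].
Proof.
have Mc := dyer_matrix_cox.
split; first split=> //= [u v u1 v1|u u1].
- by rewrite (dyer_wordM u v) u1 v1.
- by rewrite dyer_word_winv; exact: (rev_cox_proper Mc u1).
move=> u g /= u1; rewrite /conjg [X in X ~~~ _](_ : _ =
  dyer_word f (fword (g^-1 * (u * g)%g)%g)) // dyer_wordM (dyer_wordM u g) u1.
by rewrite dyer_word_winv (cox_rev Mc).
Qed.

(** The map to the Coxeter group is well defined: power relations and braid relations between
    involutions become relators, and any other relation is a commutation between words whose letters
    commute pairwise. *)
Lemma dyer_word_relator u : normal_closure (dyer_relators f m) u ->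
  dyer_word f (fword u) ~~~ [::].
Proof.
have Mc := dyer_matrix_cox.
apply: (normal_closure_sub dyer_word_normal) => {u} u [] /=.
  case=> i [k [fi ->]]; have [fi2|fi2] := eqVneq (f i) (Some 2).
    move: fi; rewrite fi2 => -[<-]; rewrite expg2 (dyer_wordM (fgen i) (fgen i)).
    by rewrite /dyer_word /dyer_letter /= fi2 eqxx /= (cox_sq Mc).
  have Mi : M (i, false) (i, true) = Some k by rewrite /dyer_matrix /= eqxx.
  have := cox_rel [::] [::] Mi; rewrite /= cats0 => <-.
  elim: (k) => [|l IH] //; rewrite expgS (dyer_wordM (fgen i) (fgen i ^+ l)%g) IH.
  by rewrite /dyer_word /dyer_letter /= (negbTE fi2).
case=> i [j [k [ij mij ->]]].
rewrite (dyer_wordM (alt_prod (fgen i) (fgen j) k) (alt_prod (fgen j) (fgen i) k)^-1%g).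
rewrite [in X in _ ++ X]/= dyer_word_winv.
suff -> : dyer_word f (fword (alt_prod (fgen i) (fgen j) k)) ~~~
          dyer_word f (fword (alt_prod (fgen j) (fgen i) k)) by rewrite (cox_revr Mc).
have [/andP[/eqP fi /eqP fj]|/(dyer_data_commute ij mij) k2] :=
    boolP ((f i == Some 2) && (f j == Some 2)).
  rewrite !dyer_word_alt_prod //; apply: (cox_catIr Mc (w := rev (alt_word (j, true) (i, true) k))).
  rewrite (cox_revr Mc).
  have Mij : M (i, true) (j, true) = Some k by rewrite /dyer_matrix /= (negbTE ij).
  have := cox_rel [::] [::] Mij; rewrite /= cats0 -addnn alt_wordD.
  by rewrite rev_alt_word; case: odd.
have alt2 a b : dyer_word f (fword (alt_prod (fgen a) (fgen b) 2)) ~~~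
    dyer_letter f (a, false) ++ dyer_letter f (b, false).
  rewrite [alt_prod _ _ _]/= mulg1 (dyer_wordM (fgen a) (fgen b)).
  by rewrite /dyer_word /= !cats0.
rewrite k2 !alt2; apply: cox_cat_swap => p q /mem_dyer_letter pi /mem_dyer_letter qj.
by rewrite /dyer_matrix pi qj (negbTE ij) mij k2; case: ifP.
Qed.

End DyerCoxeter.

(** * The action of the Coxeter group on the Dyer group *)

Section DyerAction.
Local Open Scope group_scope.
Local Open Scope classical_set_scope.
Variables (n : nat) (f : 'I_n -> natinf) (m : 'I_n -> 'I_n -> natinf).
Hypothesis fm : dyer_data f m.
Variables (H : groupType) (h : 'I_n -> H).
Hypothesis h_surj : forall x, exists u, free_lift h u = x.
Hypothesis h_ker : forall u,
  free_lift h u = 1 <-> normal_closure (dyer_relators f m) u.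
Local Notation M := (dyer_matrix f m).

(** Von Dyck's theorem: two preimages of an element differ by a consequence of the relators. *)
Lemma presented_lift (G : groupType) (g : 'I_n -> G) :
  dyer_relators f m `<=` [set u | free_lift g u = 1] ->
  exists2 p : H -> G, {morph p : x y / x * y} & forall i, p (h i) = g i.
Proof.
move=> rel; have [r rP] := choice h_surj.
have pE u : free_lift g (r (free_lift h u)) = free_lift g u.
  apply: (mulIg (free_lift g u)^-1); rewrite mulgV -free_liftV -free_liftM.
  apply: (normal_closure_sub (morph_ker_normal (free_liftM g)) rel).
  by apply/h_ker; rewrite free_liftM free_liftV rP mulgV.
exists (fun x => free_lift g (r x)) => [x y|i].
  by rewrite -{1}[x]rP -{1}[y]rP -free_liftM pE free_liftM.
by rewrite -(free_lift_gen h i) pE free_lift_gen.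
Qed.

Lemma presented_morph_eq (G : groupType) (p q : H -> G) :
  {morph p : x y / x * y} -> {morph q : x y / x * y} ->
  (forall i, p (h i) = q (h i)) -> p =1 q.
Proof.
move=> pM qM pq x; have [u <-] := h_surj x.
rewrite (morph_free_lift h pM) (morph_free_lift h qM).
by congr (free_lift _ u); apply/funext.
Qed.

Lemma dyer_gen_rel :
  (forall i k, f i = Some k -> h i ^+ k = 1) /\
  (forall i j k, i != j -> m i j = Some k ->
     alt_prod (h i) (h j) k = alt_prod (h j) (h i) k).
Proof.
by apply/dyer_relators_ker => u /sub_normal_closure/h_ker.
Qed.

Definition flip_gen i j : H :=
  if (j == i) && (f i != Some 2) then (h j)^-1 else h j.

Lemma commute_flip_gen i j a b :
  commute (h a) (h b) -> commute (flip_gen i a) (flip_gen j b).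
Proof.
rewrite /flip_gen => C; case: ifP => _; case: ifP => _ //.
- by apply/commute_sym/commuteV/commute_sym/commuteV.
- exact/commute_sym/commuteV/commute_sym.
- exact: commuteV.
Qed.

(** Power relations and commutations survive inversion of a generator. A braid relation of another
    length involves only generators of order 2, which every iota_i fixes. *)
Lemma dyer_flip_exists : exists iota : 'I_n -> H -> H,
  (forall i, {morph iota i : x y / x * y}) /\
  forall i j, iota i (h j) = flip_gen i j.
Proof.
have [relf relm] := dyer_gen_rel.
suff /choice[iota iotaP] : forall i, exists p : H -> H,
    {morph p : x y / x * y} /\ forall j, p (h j) = flip_gen i j.
  by exists iota; split=> i; case: (iotaP i).
move=> i; have [] := @presented_lift H (flip_gen i); last by move=> p pM pE; exists p.
apply/dyer_relators_ker; split=> [j k fj|j l k jl mjl].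
  by rewrite /flip_gen; case: ifP => _; rewrite ?expVgn relf ?invg1.
have [fi|fi] := eqVneq (f i) (Some 2).
  by rewrite /flip_gen fi eqxx !andbF; exact: relm.
have [k2|] := eqVneq k 2; last first.
  move=> k2; rewrite /flip_gen.
  have ne a b : a != b -> m a b = Some k -> (a == i) = false.
    move=> ab mab; apply/eqP => ai; case/eqP: k2.
    by apply: (dyer_data_commute fm ab mab); rewrite ai (negbTE fi).
  rewrite (ne j l) // (ne l j) 1?eq_sym //; first exact: relm.
  by case: fm => _ /(_ j l jl)[<-].
have C : commute (h j) (h l).
  by have := relm _ _ _ jl mjl; rewrite k2 /= !mulg1.
by rewrite k2 /= !mulg1; exact: commute_flip_gen.
Qed.

(** Stands in for the semidirect product: [(i, false)] acts on [H] by [iota i], and [(i, true)] by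
    left multiplication by [h i] followed by [iota i]. *)
Lemma dyer_action_exists : exists a : 'I_n * bool -> H -> H,
  (forall p q k, M p q = Some k ->
     forall x, foldr a x (alt_word p q k.*2) = x) /\
  forall w x, foldr a x (dyer_word f w) = word_val h w * x.
Proof.
have [relf relm] := dyer_gen_rel.
have [iota [iotaM iotaE]] := dyer_flip_exists.
have iotaV i x : iota i x^-1 = (iota i x)^-1.
  have iota1 : iota i 1 = 1 by apply: (mulgI (iota i 1)); rewrite -iotaM !mulg1.
  by apply: (mulIg (iota i x)); rewrite -iotaM !mulVg.
have iota_flip i j l : iota i (flip_gen j l) =
    if (l == i) && (f i != Some 2) then (flip_gen j l)^-1 else flip_gen j l.
  by rewrite /flip_gen; case: ifP => _; rewrite ?iotaV iotaE /flip_gen; case: ifP.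
have iotaK i : involutive (iota i).
  move=> x; apply: (@presented_morph_eq _ (iota i \o iota i) id) => // [y z|j] /=.
    by rewrite !iotaM.
  by rewrite iotaE iota_flip /flip_gen; case: (_ && _); rewrite ?invgK.
have iotaC i j : i != j -> forall x, iota i (iota j x) = iota j (iota i x).
  move=> ij; apply: (@presented_morph_eq _ (iota i \o iota j) (iota j \o iota i))
    => [y z|y z|l] /=; rewrite ?iotaM //.
  rewrite !iotaE !iota_flip /flip_gen.
  by case: (eqVneq l i) => [->|_]; rewrite ?(negbTE ij) /=; do ?case: ifP => _.
have iota2 i : f i = Some 2 -> iota i =1 id.
  move=> fi; apply: presented_morph_eq => // j.
  by rewrite iotaE /flip_gen fi eqxx andbF.
pose a (p : 'I_n * bool) x := iota p.1 (if p.2 then h p.1 * x else x).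
have hV i : f i = Some 2 -> (h i)^-1 = h i.
  by move=> /relf; rewrite expg2 => /mulg1_eq.
have aK p : involutive (a p).
  case: p => i [] x; rewrite /a /= ?iotaK //.
  rewrite [LHS]iotaM iotaK iotaE mulgA /flip_gen.
  rewrite eqxx /=; have [fi|_] := eqVneq (f i) (Some 2); last by rewrite mulVg mul1g.
  by rewrite /= -{1}(hV i fi) mulVg mul1g.
have aa i x : a (i, false) (a (i, true) x) = h i * x by rewrite /a /= iotaK.
have aa' i x : a (i, true) (a (i, false) x) = flip_gen i i * x.
  by rewrite /a /= iotaM iotaE iotaK.
have flipX i k : f i = Some k -> flip_gen i i ^+ k = 1.
  by move=> fi; rewrite /flip_gen; case: ifP => _; rewrite ?expVgn relf ?invg1.
have iter_mul (y : H) k (x : H) : iter k ( *%g y) x = y ^+ k * x.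
  by elim: k => [|k IH]; [rewrite mul1g | rewrite iterS IH expgS mulgA].
have acomm p q : (forall x, a p (a q x) = a q (a p x)) ->
    forall x, foldr a x (alt_word p q 4) = x.
  by move=> C x /=; rewrite C !aK.
exists a; split.
  move=> [i b] [j c] k; rewrite /dyer_matrix /=.
  have [<-|ij] := eqVneq i j.
    have [<-|] := eqVneq b c; first by case=> <- x /=; rewrite aK.
    move=> bc fi x; rewrite foldr_alt_word_iter.
    case: b c bc => [] [] // _.
      by rewrite (eq_iter (aa' i)) iter_mul flipX // mul1g.
    by rewrite (eq_iter (aa i)) iter_mul relf // mul1g.
  have [/andP[bT cT] mij|nbc [<-]] := boolP (b && c); last first.
    apply: acomm => x; case: b c nbc => [] [] // _; rewrite /a /=.
    - by rewrite !iotaM !iotaE iota_flip (negbTE ij) /= iotaC.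
    - by rewrite !iotaM !iotaE iota_flip eq_sym (negbTE ij) /= iotaC.
    - exact: iotaC.
  rewrite {b}bT {c}cT.
  have [/andP[/eqP fi /eqP fj]|f2] := boolP ((f i == Some 2) && (f j == Some 2)).
    apply/(foldr_alt_wordC aK) => x.
    have altE l s t : f s = Some 2 -> f t = Some 2 ->
        foldr a x (alt_word (s, true) (t, true) l) = alt_prod (h s) (h t) l * x.
      elim: l s t => [|l IH] s t fs ft /=; first by rewrite mul1g.
      by rewrite IH // /a /= iota2 // mulgA.
    by rewrite !altE // (relm i j).
  have k2 := dyer_data_commute fm ij mij f2; rewrite k2; apply: acomm => x.
  have C : commute (h i) (h j) by have := relm _ _ _ ij mij; rewrite k2 /= !mulg1.
  have C' : commute (flip_gen i i) (flip_gen j j) by exact: commute_flip_gen.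
  rewrite /a /= !iotaM !iotaE !iota_flip [j == i]eq_sym (negbTE ij) /= iotaC //.
  by rewrite !mulgA C'.
move=> w x; elim: w => [|[i b] w IH] /=; first by rewrite /word_val big_nil mul1g.
rewrite /dyer_word /= foldr_cat -/(dyer_word f w) IH /word_val big_cons -mulgA.
move: (_ * x) => y; rewrite /dyer_letter /letter_val /=.
have [fi|fi] := eqVneq (f i) (Some 2).
  by rewrite /= /a /= iota2 //; case: b; rewrite // hV.
by case: b; rewrite [foldr _ _ _]/= ?aa ?aa' // /flip_gen eqxx fi.
Qed.

End DyerAction.

(** The Coxeter word of [u] for [(f, m)] has length at most [L] and acts on the group of [(f', m')],
    where the relators with exponents up to [L] hold. Being trivial in the Coxeter group, it fixes
    1. *)
Lemma dyer_relation_transfer (R : realType) n f m f' m' (L : nat)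
    (u : free_group n) :
  dyer_data f m -> dyer_data f' m' ->
  (forall i k, k <= L -> f i = Some k <-> f' i = Some k) ->
  (forall i j k, i != j -> k <= L -> m i j = Some k -> m' i j = Some k) ->
  1 < L -> (size (fword u)).*2 <= L ->
  normal_closure (dyer_relators f m) u -> normal_closure (dyer_relators f' m') u.
Proof.
move=> fm fm' ff' mm' L2 uL Ku.
have [H [p [pM p_surj p_ker]]] :=
  quotient_group_exists (normal_closure_normal (dyer_relators f' m')).
pose h i := p (fgen i); have pE := free_lift_unique pM.
have h_surj x : exists v, free_lift h v = x.
  by have [v <-] := p_surj x; exists v; rewrite pE.
have h_ker v : free_lift h v = 1%g <-> normal_closure (dyer_relators f' m') v.
  by rewrite -p_ker pE.
have [a [aM aE]] := dyer_action_exists fm' h_surj h_ker.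
apply/h_ker; rewrite -[free_lift h u]mulg1 -aE.
(* As 2 <= L, both data have the same generators of order 2, hence the same encoding. *)
have -> : dyer_word f' (fword u) = dyer_word f (fword u).
  congr flatten; apply: eq_map => b; rewrite /dyer_letter.
  suff -> : (f' b.1 == Some 2) = (f b.1 == Some 2) by [].
  by apply/eqP/eqP => /ff'; apply.
apply: (cox_trivial_act R (dyer_matrix_cox fm) (ltnW L2) _ _
  (dyer_word_relator fm Ku)).
  move=> q r k kL Mqr; apply: aM; move: Mqr.
  rewrite /dyer_matrix; case: eqVneq => [_|qr].
    by case: ifP => // _ /ff'; apply.
  by case: ifP => // _; exact: mm'.
exact: leq_trans (size_dyer_word _ _) uL.
Qed.

(** * Limits of Dyer systems *)

Section Limits.
Local Open Scope classical_set_scope.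

(** A value taken on a set of [U] is the limit. If there is none, every finite value is avoided on a
    set of [U], and the limit is infinite. *)
Lemma ultra_natinf_limit (U : set_system nat) (q : nat -> natinf) :
  UltraFilter U -> exists l : natinf, forall B,
    U [set r | forall k, k <= B -> q r = Some k <-> l = Some k].
Proof.
move=> UU; have [[k Uk]|noU] := pselect (exists k, U [set r | q r = Some k]).
  by exists (Some k) => B; apply: filterS Uk => r /= ->.
exists None; elim=> [|B IH].
  have [U0|U0] := in_ultra_setVsetC [set r | q r = Some 0] UU.
    by case: noU; exists 0.
  by apply: filterS U0 => r /= nq k; rewrite leqn0 => /eqP ->.
have [UB|UB] := in_ultra_setVsetC [set r | q r = Some B.+1] UU.
  by case: noU; exists B.+1.
apply: filterS (filterI IH UB) => r [/= qB nq] k.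
by rewrite leq_eqVlt => /orP[/eqP ->|]; [split|exact: qB].
Qed.

(** One ultrafilter containing all tails serves every index at once, replacing successive
    subsequences. *)
Lemma natinf_family_cluster (I : finType) (q : nat -> I -> natinf) :
  exists l : I -> natinf, forall B, exists2 r, B <= r &
    forall i k, k <= B -> q r i = Some k <-> l i = Some k.
Proof.
have [U [UU subU]] := ultraFilterLemma eventually_filter.
have /choice[l lP] i := ultra_natinf_limit (fun r => q r i) UU.
exists l => B; have UB : U [set r | B <= r] by apply/subU/nbhs_infty_ge.
have Ul : U [set r | forall i k, k <= B -> q r i = Some k <-> l i = Some k].
  by apply: filter_forall => i; exact: lP.
by have [r [rB rl]] := filter_ex (filterI UB Ul); exists r.
Qed.

(** Each condition on Dyer data concerns finitely many finite exponents, so a single well-chosen [r]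
    passes it on to the limit. *)
Lemma dyer_data_cluster n (fs : nat -> 'I_n -> natinf)
    (ms : nat -> 'I_n -> 'I_n -> natinf) :
  (forall r, dyer_data (fs r) (ms r)) ->
  exists f m, dyer_data f m /\ forall B, exists2 r, B <= r &
    (forall i k, k <= B -> fs r i = Some k <-> f i = Some k) /\
    (forall i j k, k <= B -> ms r i j = Some k <-> m i j = Some k).
Proof.
move=> fms.
pose q r (x : 'I_n + 'I_n * 'I_n) :=
  match x with inl i => fs r i | inr ij => ms r ij.1 ij.2 end.
have [l lP] := natinf_family_cluster q.
pose f i := l (inl i); pose m i j := l (inr (i, j)).
have fmP B : exists2 r, B <= r &
    (forall i k, k <= B -> fs r i = Some k <-> f i = Some k) /\
    (forall i j k, k <= B -> ms r i j = Some k <-> m i j = Some k).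
  have [r rB rl] := lP B; exists r => //; split=> [i|i j].
    exact: (rl (inl i)).
  exact: (rl (inr (i, j))).
exists f, m; split=> //; split=> [i|i j ij].
  case fi: (f i) => [k|] //; have [r _ [/(_ i k (leqnn k)) rf _]] := fmP k.
  by case: (fms r) => /(_ i); rewrite (rf.2 fi).
have mS k : m i j = Some k <-> m j i = Some k.
  have [r _ [_ rm]] := fmP k; rewrite -!rm //.
  by case: (fms r) => _ /(_ _ _ ij)[->].
split.
- case mij: (m i j) => [k|]; first by rewrite (mS k).1.
  by case mji: (m j i) => [k|] //; rewrite (mS k).2 in mij.
- case mij: (m i j) => [k|] //; have [r _ [_ /(_ i j k (leqnn k)) rm]] := fmP k.
  by case: (fms r) => _ /(_ _ _ ij)[_ + _]; rewrite (rm.2 mij).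
case mij: (m i j) => [k|] f3; last by right.
(* The bound is at least [k] to preserve [m i j], and at least 2 to tell which generators are
   involutions. *)
left; have [r rB [rf rm]] := fmP (maxn 2 k).
rewrite (dyer_data_commute (fms r) ij (k := k)) //.
  by apply/rm => //; rewrite leq_maxr.
apply/negP => /andP[/eqP + /eqP]; rewrite !rf ?leq_maxl // => fi fj.
by rewrite fi fj in f3.
Qed.

Lemma marked_dyer_limit (R : realType) n (G : marked_group n) :
  (forall r, exists2 D, is_marked_dyer D & agree_upto G D r) ->
  is_marked_dyer G.
Proof.
move=> GD; have /choice[fms fmsP] r : exists fm : ('I_n -> natinf) * ('I_n -> 'I_n -> natinf),
    dyer_data fm.1 fm.2 /\ exists2 D : marked_group n,
    has_presentation D (dyer_relators fm.1 fm.2) & agree_upto G D r.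
  by have [D [f [m [fm presD]]] GD_r] := GD r; exists (f, m); split=> //; exists D.
have agree r u : size (fword u) <= r ->
    marked_ker G u <-> normal_closure (dyer_relators (fms r).1 (fms r).2) u.
  move=> ur; have [_ [D <- /seteqP[GD1 GD2]]] := fmsP r.
  have bu : @word_ball n r u by exists (fword u) => //; exact: word_val_fgen.
  by split=> Ku; [have [] := GD1 u | have [] := GD2 u].
have [f [m [fm fmP]]] := dyer_data_cluster (fun r => (fmsP r).1).
exists f, m; split=> //; apply/seteqP; split=> u.
  (* Twice the length of [u] bounds its Coxeter word; the extra 2 ensures 1 < L even for the empty
     word. *)
  have [r rB [rf rm]] := fmP (size (fword u)).*2.+2.
  have ur : size (fword u) <= r.
    by apply: leq_trans rB; rewrite -addnn; apply/leqW/leqW/leq_addr.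
  move/(agree r u ur).1.
  apply: (dyer_relation_transfer R (L := (size (fword u)).*2.+2)) => //.
  - exact: (fmsP r).1.
  - by move=> i j k _ kB /rm ->.
  - exact/leqW/leqW.
(* Conversely, each relator of the limit data is a relator of some approximating system that agrees
   with [G] on a ball containing it. *)
apply: (normal_closure_sub (morph_ker_normal (free_liftM (mg_gen G)))).
move=> {}u ur; suff [r ru /sub_normal_closure/agree] : exists2 r,
    size (fword u) <= r & dyer_relators (fms r).1 (fms r).2 u by apply.
case: ur => [[i [k [fi ->]]]|[i [j [k [ij mij ->]]]]].
  have [r rB [rf _]] := fmP (size (fword (fgen i ^+ k)%g) + k).
  exists r; first exact: leq_trans (leq_addr _ _) rB.
  by left; exists i, k; split=> //; apply/rf => //; exact: leq_addl.
set u' := (_ * _)%g; have [r rB [_ rm]] := fmP (size (fword u') + k).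
exists r; first exact: leq_trans (leq_addr _ _) rB.
by right; exists i, j, k; split=> //; apply/rm => //; exact: leq_addl.
Qed.

End Limits.

(** * From distances to agreement on balls *)

Lemma marked_dist_lt_agree (R : realType) n (M N : marked_group n) r :
  (marked_dist R M N < expR (- r%:R))%R -> agree_upto M N r.
Proof.
rewrite /marked_dist; case: asboolP => [E _|neq]; first by rewrite /agree_upto /= E.
rewrite ltr_expR ltrN2 ltr_nat => /ltnW rv.
by apply: agree_upto_le rv _; have [] := agree_maxP neq.
Qed.

Theorem theorem1 (R : realType) (n : nat) (hn : (1 <= n)%N) :
  closed (@dyer_space R n).
Proof.
move=> C clC; exists (class_repr C); last exact: class_reprK.
apply: (marked_dyer_limit R) => r.
have [_ [[D dD <-]]] := clC _ (nbhsx_ballx C (expR (- r%:R)%R) (expR_gt0 _)).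
rewrite ballEmdist /= -[X in (mdist X _ < _)%R]class_reprK.
rewrite -[mdist _ _]/(class_dist _ _) class_distE => /marked_dist_lt_agree.
by exists D.
Qed.
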